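(* For every constant $\delta\in(0,1)$ there exists a constant $k_0(\delta)$ such that the following holds. Put $\varphi(k)=4\left\lfloor\sqrt{\frac{\ln k}{\ln(2\ln k)}}\right\rfloor^{-1}$. Let $k=k(n)$ and $r=r(n)\ge 2$ be integer-valued functions of $n$ with $k\ge k_0(\delta)$ and $$(k-1)\ln r<\frac{1-\delta}{2}\ln n,\qquad r^{k-1}k^{-\varphi(k)}\ge 6\ln n .$$ Then for any function $p=p(n)\in[0,1]$ satisfying $$p\le \frac12\,\frac{r^{k-1}}{k^{1+\varphi(k)}}\,\frac{n}{\binom nk},$$ we have ${\sf P}\left(H(n,k,p)\text{ is } r\text{-colorable}\right)\to 1$ as $n\to\infty$.
   Context: A hypergraph is a pair $H=(V,E)$ with $V$ a finite set and $E$ a collection of subsets of $V$ (edges); it is $k$-uniform if every edge has exactly $k$ vertices. A vertex coloring is proper for $H$ if no edge is monochromatic; $H$ is $r$-colorable if it has a proper coloring with $r$ colors. For integers $n>k\ge 2$ and $p\in[0,1]$, $H(n,k,p)$ is the random $k$-uniform hypergraph on $n$ vertices in which each of the $\binom nk$ $k$-subsets of the vertex set is included as an edge independently with probability $p$. *)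

(* Defs.v *)
From mathcomp Require Import all_boot all_order all_algebra.
From mathcomp Require Import all_classical all_reals all_analysis.

Set Implicit Arguments.
Unset Strict Implicit.
Unset Printing Implicit Defensive.

Import Order.TTheory GRing.Theory Num.Theory.
Import numFieldNormedType.Exports.

Local Open Scope ring_scope.

(* A hypergraph on the vertex set V is represented by its set of edges. *)
Definition hypergraph (V : finType) := {set {set V}}.

Definition uniform (V : finType) (k : nat) (E : hypergraph V) : bool :=
  [forall e in E, #|e| == k].

Definition monochromatic (V : finType) (r : nat) (c : {ffun V -> 'I_r})
    (e : {set V}) : bool :=
  [exists i : 'I_r, [forall v in e, c v == i]].

Definition proper_coloring (V : finType) (r : nat) (E : hypergraph V)
    (c : {ffun V -> 'I_r}) : bool :=
  [forall e in E, ~~ monochromatic c e].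

Definition colorable (V : finType) (r : nat) (E : hypergraph V) : bool :=
  [exists c : {ffun V -> 'I_r}, proper_coloring E c].

(* The law of H(n,k,p): a product of Bernoulli(p) laws, one for each k-subset
   of the n vertices, supported on the k-uniform hypergraphs. *)
Definition Hnkp_mass (R : realType) (n k : nat) (p : R)
    (E : hypergraph 'I_n) : R :=
  if uniform k E then
    \prod_(e : {set 'I_n} | #|e| == k) (if e \in E then p else 1 - p)
  else 0.

Definition Hnkp_prob (R : realType) (n k : nat) (p : R)
    (A : pred (hypergraph 'I_n)) : R :=
  \sum_(E : hypergraph 'I_n | A E) Hnkp_mass k p E.

Definition varphi (R : realType) (k : nat) : R :=
  4 * ((Num.floor (Num.sqrt (ln k%:R / ln (2 * ln k%:R) : R)))%:~R)^-1.

(* Main.v *)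
Require Import Defs.
From mathcomp Require Import all_boot all_order all_algebra.
From mathcomp Require Import all_classical all_reals all_analysis.
From mathcomp Require Import zify ring lra.

(* A weighted second moment argument.  Write u = r^(k-1), N = C(n,k) and
   w = 1 / (1 - 1/u).  For a coloring c put
     z_c(E) = w^|E| [c is proper for E] / (expectation of the numerator)
   and let x be the average of z_c over the colorings c whose color classes all
   have size (1 +- 1/k) n/r.  Then x has mean 1 and vanishes when E is not
   colorable, so it suffices that x has second moment 1 + o(1).  Without the
   factor w^|E| this fails, because the fluctuations of the number of edges
   alone blow up the second moment; with it, the pair (c, d) contributes
     exp (p w^2 (N/u^2 - N_c/u - N_d/u + N_cd) + O(p^2 N)),
   where N_c counts the k-sets monochromatic for c and N_cd those monochromatic
   for both c and d.

   For fixed c the classes of d split each class of c into cells of mean size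
   (class size) / r.  Expanding the k-th powers of the cell sizes to second order
   bounds the exponent by A D + o(1), where D is the sum of the squared deviations
   of the cell sizes from their means and A n = o(1) as long as no cell exceeds
   its mean by a factor 4/3; otherwise D is of order n^2 / r^4 at least and a
   cruder A of order r / (k n) is enough.  The deviations are sums of independent
   centered vectors, and E exp (A D) <= exp (2 A n) if A times each class size is
   at most 1/16.  The total error is O(1 / (k r)), and k r tends to infinity
   because r^(k-1) >= 6 ln n. *)

Set Implicit Arguments.
Unset Strict Implicit.
Unset Printing Implicit Defensive.

Import Order.TTheory GRing.Theory Num.Theory.
Import numFieldNormedType.Exports.

Local Open Scope ring_scope.

(** * Elementary inequalities for the exponential and for powers *)

Section RealInequalities.
Variable R : realType.
Implicit Types (x y z u M : R) (k : nat).

(** Squaring [exp (- u / 2) >= 1 - u / 2 > 0] reduces the claim to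
    [(1 + u + 2 u^2) (1 - u / 2)^2 >= 1], where the difference of the two sides is
    [u^2 (1 - u) (5 - 2 u) / 4]. *)
Lemma expR_le_quadratic u : u <= 1 -> expR u <= 1 + u + 2 * u ^+ 2.
Proof.
move=> u1.
have v0 : 0 < 1 - u / 2 by lra.
have h : (1 - u / 2) ^+ 2 <= expR (- u).
  have -> : expR (- u) = expR (- (u / 2)) ^+ 2.
    by rewrite -expRM_natl; congr expR; lra.
  by rewrite ler_sqr ?nnegrE ?expR_ge0 ?(ltW v0)// expR_ge1Dx.
have {}h : expR u * (1 - u / 2) ^+ 2 <= 1.
  by rewrite -[leRHS](expRxMexpNx_1 u) ler_wpM2l ?expR_ge0.
have h2 : 1 <= (1 + u + 2 * u ^+ 2) * (1 - u / 2) ^+ 2.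
  have : 0 <= u ^+ 2 * ((1 - u) * (5 - 2 * u)) / 4.
    by rewrite divr_ge0// mulr_ge0 ?sqr_ge0// mulr_ge0//; lra.
  by nra.
by rewrite -(ler_pM2r (exprn_gt0 2 v0)); apply: le_trans h h2.
Qed.

(** When [u] is averaged over centered values the linear term drops out, which leaves a sub-Gaussian
    bound. *)
Lemma expR_le_add_expR_sq u : expR u <= u + expR (2 * u ^+ 2).
Proof.
have [u1|u1] := leP u 1.
  apply: le_trans (expR_le_quadratic u1) _.
  by have := expR_ge1Dx (2 * u ^+ 2); lra.
have : expR u <= expR (2 * u ^+ 2) by rewrite ler_expR; nra.
lra.
Qed.

(** Convexity, by induction: [x] times the tangent for exponent [k] exceeds the tangent for exponent
    [k + 1] by [k z^(k-1) (x - z)^2]. *)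
Lemma tangent_le_exprn x z k : 0 <= x -> 0 <= z ->
  z ^+ k + k%:R * z ^+ k.-1 * (x - z) <= x ^+ k.
Proof.
move=> x0 z0; elim: k => [|k IH]; first by rewrite !expr0; lra.
have -> : z ^+ k.+1 + k.+1%:R * z ^+ k.+1.-1 * (x - z) =
          x * (z ^+ k + k%:R * z ^+ k.-1 * (x - z))
          - k%:R * z ^+ k.-1 * (x - z) ^+ 2.
  case: k {IH} => [|k] /=; first by rewrite !expr0 expr1; ring.
  by rewrite -!natr1 !exprS; ring.
rewrite [x ^+ k.+1]exprS lerBlDr ler_wpDr//; last exact: ler_wpM2l.
by rewrite mulr_ge0 ?sqr_ge0// mulr_ge0 ?ler0n ?exprn_ge0.

Qed.

(** The quadratic coefficient is cruder than Taylor's so that the induction on the exponent closes: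
    multiplying by [x] leaves a slack of [(x - z)^2] times a sum of nonnegative terms. *)
Lemma exprn_le_taylor2 x z M k : 0 <= x <= M -> 0 <= z <= M ->
  x ^+ k.+2 <= z ^+ k.+2 + k.+2%:R * z ^+ k.+1 * (x - z)
               + k.+2%:R ^+ 2 * M ^+ k * (x - z) ^+ 2.
Proof.
move=> /andP[x0 xM] /andP[z0 zM].
have M0 : 0 <= M := le_trans x0 xM.
elim: k => [|k IH].
  rewrite expr0 mulr1; have := sqr_ge0 (x - z); nra.
have -> : x ^+ k.+3 = x * x ^+ k.+2 by rewrite exprS.
apply: le_trans (ler_wpM2l x0 IH) _.
rewrite -subr_ge0.
have -> : z ^+ k.+3 + k.+3%:R * z ^+ k.+2 * (x - z) +
    k.+3%:R ^+ 2 * M ^+ k.+1 * (x - z) ^+ 2 -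
    x * (z ^+ k.+2 + k.+2%:R * z ^+ k.+1 * (x - z) +
     k.+2%:R ^+ 2 * M ^+ k * (x - z) ^+ 2) =
   (x - z) ^+ 2 * (k.+2%:R ^+ 2 * M ^+ k * (M - x)
     + k.+2%:R * (M ^+ k.+1 - z ^+ k.+1) + (k.+3%:R) * M ^+ k.+1).
  by rewrite -!natr1 !exprS; ring.
rewrite mulr_ge0 ?sqr_ge0// !addr_ge0// !mulr_ge0 ?exprn_ge0 ?ler0n ?subr_ge0//.
by rewrite lerXn2r ?nnegrE.
Qed.

End RealInequalities.

(** * Exponential moments of the cell deviations of a random coloring *)

Section ColorDeviation.
Variables (R : realType) (V C I : finType).
Implicit Types (t : {ffun V -> C}) (T : {set V}) (A : I -> R).

Definition recolor t (v : V) (c : C) : {ffun V -> C} :=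
  [ffun x => if x == v then c else t x].

(** Resampling the color of one vertex preserves the uniform law: sending [(t, c)] to the recolored
    [t] together with the old color of [v] is an involution. *)
Lemma sum_recolor (F : {ffun V -> C} -> R) (v : V) :
  \sum_t \sum_c F (recolor t v c) = #|C|%:R * \sum_t F t.
Proof.
transitivity (\sum_t \sum_(c : C) F t); last first.
  rewrite mulr_sumr; apply: eq_bigr => t _.
  by rewrite sumr_const mulr_natl.
rewrite !pair_big /=.
pose h (x : {ffun V -> C} * C) := (recolor x.1 v x.2, x.1 v).
have hK : involutive h.
  case=> t c; rewrite /h /= ffunE eqxx; congr pair.
  by apply/ffunP => x; rewrite !ffunE; case: eqP => [->|].
by rewrite [RHS](reindex_inj (inv_inj hK)).
Qed.

(** With [S] the squared norm of [w] and [m] its mean, the new squared norm is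
    [S + 2 (w c - m) + 1 - 1/|C|]. The middle term is centered over [c] and its square is at most
    [4 S], so averaging its exponential costs only [8 a^2 S] in the exponent. *)
Lemma sum_expR_one_step (w : C -> R) (a : R) : 0 <= a ->
  \sum_c expR (a * \sum_j (w j + ((c == j)%:R - #|C|%:R^-1)) ^+ 2)
  <= #|C|%:R * expR (a * (1 + 8 * a) * (\sum_j w j ^+ 2) + a).
Proof.
move=> a0.
have [C0|C0] := posnP #|C|.
  by rewrite big1 ?C0 ?mul0r// => c _; have := fintype0 c C0.
set S := \sum_j w j ^+ 2; set q : R := #|C|%:R.
have q1 : 1 <= q by rewrite ler1n.
have q0 : q != 0 by rewrite gt_eqF// (lt_le_trans ltr01).
pose m := (\sum_j w j) / q.
have sqE c : \sum_j (w j + ((c == j)%:R - q^-1)) ^+ 2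
    = S + 2 * (w c - m) + (1 - q^-1).
  have delta (f : C -> R) : \sum_j (c == j)%:R * f j = f c.
    rewrite (bigD1 c)//= eqxx mul1r big1 ?addr0// => j /negPf.
    by rewrite eq_sym => ->; rewrite mul0r.
  have term j : (w j + ((c == j)%:R - q^-1)) ^+ 2 = w j ^+ 2 +
      (c == j)%:R * (2 * w j + 1 - 2 * q^-1) + (q^-1 ^+ 2 - 2 * q^-1 * w j).
    by case: (c == j) => /=; ring.
  under eq_bigr => j _ do rewrite term.
  rewrite !big_split /= delta -/S sumrN sumr_const -mulr_sumr.
  rewrite -[_ *+ #|C|]mulr_natl -/q /m.
  by field.
have sumwm : \sum_c (w c - m) = 0.
  rewrite sumrB sumr_const -[X in _ - X]mulr_natl -/q /m mulrC.
  by rewrite divfK// subrr.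
have varS c : (w c - m) ^+ 2 <= S.
  have : (w c - m) ^+ 2 <= \sum_j (w j - m) ^+ 2.
    by rewrite (bigD1 c)//= lerDl sumr_ge0// => j _; rewrite sqr_ge0.
  move=> /le_trans; apply.
  have -> : \sum_j (w j - m) ^+ 2 = S - q * m ^+ 2.
    under eq_bigr => j _.
      rewrite (_ : _ ^+ 2 = w j ^+ 2 + (m ^+ 2 - 2 * m * w j)); last by ring.
      over.
    rewrite !big_split /= sumrN sumr_const -mulr_sumr -[_ *+ #|C|]mulr_natl -/q -/S.
    have -> : \sum_j w j = q * m by rewrite /m mulrC divfK.
    by ring.
  by rewrite gerBl mulr_ge0 ?sqr_ge0// (le_trans ler01).
apply: le_trans (_ : \sum_c expR (a * S + a) * expR (2 * a * (w c - m)) <= _).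
  apply: ler_sum => c _; rewrite -expRD ler_expR sqE.
  have q10 : 0 <= q^-1 by rewrite invr_ge0 (le_trans ler01).
  by have := mulr_ge0 a0 q10; lra.
rewrite -mulr_sumr.
apply: le_trans (ler_wpM2l (expR_ge0 _) (_ : _ <= q * expR (8 * a ^+ 2 * S))) _.
  apply: le_trans (ler_sum _ (fun c _ => expR_le_add_expR_sq (2 * a * (w c -
    m)))) _.
  rewrite big_split /= -mulr_sumr sumwm mulr0 add0r.
  apply: le_trans (_ : \sum_(c : C) expR (8 * a ^+ 2 * S) <= _).
    apply: ler_sum => c _.
    by rewrite ler_expR; have := ler_wpM2l (sqr_ge0 a) (varS c); lra.
  by rewrite sumr_const -[leLHS]mulr_natl.
rewrite mulrCA -expRD.
by apply: ler_wpM2l; [exact: le_trans ler01 q1|rewrite ler_expR; lra].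
Qed.

Variable s : V -> I.

(** Here [s] is the fixed coloring, [t] the random one, and [T] limits the count to some of the
    vertices, so that they can be removed one by one. For uniform [t] this is a sum of independent
    centered terms. *)
Definition dev T t (i : I) (j : C) : R :=
  \sum_(v in T | s v == i) ((t v == j)%:R - #|C|%:R^-1).

Definition sqdev T t (i : I) : R := \sum_j dev T t i j ^+ 2.

Lemma sqdev_ge0 T t i : 0 <= sqdev T t i.
Proof. by apply: sumr_ge0 => j _; rewrite sqr_ge0. Qed.

Definition class_in T i := #|[set v in T | s v == i]|.

Lemma dev_recolor T t v c i j : v \in T ->
  dev T (recolor t v c) i j =
  dev (T :\ v) t i j + (s v == i)%:R * ((c == j)%:R - #|C|%:R^-1).
Proof.
move=> vT; rewrite /dev.
have E : \sum_(x in T :\ v | s x == i) ((t x == j)%:R - #|C|%:R^-1) =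
   \sum_(x in T | (s x == i) && (x != v))
      ((recolor t v c x == j)%:R - #|C|%:R^-1) :> R.
  apply: congr_big => // x; first by rewrite !inE; case: (x \in T); case: eqP;
    rewrite ?andbF ?andbT.
  by rewrite !inE ffunE => /andP[/andP[/negPf->]].
have [svi|svi] := eqVneq (s v) i.
  rewrite mul1r (bigD1 v) ?vT ?svi ?eqxx//= addrC ffunE eqxx E; congr (_ + _).
  by apply: eq_bigl => x; rewrite andbA.
rewrite mul0r addr0 E; apply: eq_bigl => x.
case: (x \in T) => //=; have [sxi|//] := eqVneq (s x) i.
by apply/esym; apply: contraNneq svi => <-; rewrite sxi.
Qed.

Lemma class_in_D1 T v i : v \in T ->
  class_in T i = (class_in (T :\ v) i + (s v == i))%N.
Proof.
move=> vT; rewrite /class_in (cardsD1 v) !inE vT addnC /=; congr (_ + _)%N.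
by apply: eq_card => x; rewrite !inE andbA.
Qed.

(* Recoloring one vertex turns the weight [a] of its row into [a (1 + 8 a)];
   along at most [m] steps with [16 a m <= 1] the weight at most doubles. *)
Lemma sum_expR_sqdev T A :
  (forall i, 0 <= A i) -> (forall i, 16 * A i * (class_in T i)%:R <= 1) ->
  \sum_t expR (\sum_i A i * sqdev T t i) <=
  #|C|%:R ^+ #|V| * expR (2 * \sum_i A i * (class_in T i)%:R).
Proof.
have [n] := ubnP #|T|; elim: n => // n IH in T A *.
rewrite ltnS => Tn A0 A1.
have [->|[v vT]] := set_0Vmem T.
  have z i : class_in finset.set0 i = 0%N.
    by rewrite /class_in; apply/eqP; rewrite cards_eq0; apply/eqP/setP => x;
      rewrite !inE.
  rewrite [\sum_(i : I) _]big1; last by move=> i _; rewrite z mulr0.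
  rewrite mulr0 expR0 mulr1 (eq_bigr (fun=> 1)) ?sumr_const ?card_ffun ?natrX//.
  move=> t _; rewrite big1 ?expR0// => i _.
  by rewrite /sqdev big1 ?mulr0// => j _; rewrite /dev big1 ?expr0n// => x;
    rewrite inE.
have [C0|C0] := posnP #|C|.
  rewrite big1 ?mulr_ge0 ?exprn_ge0 ?expR_ge0 ?ler0n//.
  by move=> t _; have := fintype0 (t v) C0.
have C0' : 0 < #|C|%:R :> R by rewrite ltr0n.
(* The color of [v] is averaged out first; what remains is the induction hypothesis for [T] without
   [v] and the weights [A']. *)
rewrite -(ler_pM2l C0') -(sum_recolor _ v).
pose A' i := if i == s v then A i * (1 + 8 * A i) else A i.
have Asv0 := A0 (s v).
have A'0 i : 0 <= A' i.
  by rewrite /A'; case: eqP => // ->; rewrite mulr_ge0// addr_ge0 ?mulr_ge0.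
have step t : \sum_c expR (\sum_i A i * sqdev T (recolor t v c) i) <=
    #|C|%:R * (expR (\sum_i A' i * sqdev (T :\ v) t i) * expR (A (s v))).
  have E c : \sum_i A i * sqdev T (recolor t v c) i =
      \sum_(i | i != s v) A i * sqdev (T :\ v) t i +
      A (s v) * \sum_j (dev (T :\ v) t (s v) j + ((c == j)%:R - #|C|%:R^-1)) ^+ 2.
    rewrite (bigD1 (s v))//= addrC; congr (_ + _ * _).
      apply: eq_bigr => i; rewrite eq_sym => /negPf sv; congr (_ * _).
      by apply: eq_bigr => j _; rewrite dev_recolor// sv mul0r addr0.
    by apply: eq_bigr => j _; rewrite dev_recolor// eqxx mul1r.
  under eq_bigr => c _ do rewrite E expRD.
  rewrite -mulr_sumr.
  apply: le_trans (ler_wpM2l (expR_ge0 _) (sum_expR_one_step _ (A0 (s v)))) _.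
  rewrite mulrCA ler_wpM2l ?ler0n// -!expRD ler_expR.
  rewrite [leRHS](congr1 (+%R^~ _) (bigD1 (s v) _))//= {1}/A' eqxx.
  rewrite addrA lerD2r addrC lerD2l le_eqVlt; apply/orP; left; apply/eqP.
  by apply: eq_bigr => i /negPf iv; rewrite /A' iv.
apply: le_trans (ler_sum _ (fun t _ => step t)) _.
rewrite -mulr_sumr -mulr_suml ler_wpM2l ?ler0n//.
have Tv : (#|T :\ v| < n)%N.
  by apply: leq_trans Tn; rewrite [leqRHS](cardsD1 v) vT.
pose x : R := (class_in (T :\ v) (s v))%:R.
have x0 : 0 <= x by rewrite ler0n.
(* The class of [v] loses one vertex, and the room [16 A] this leaves pays for the increase
   [128 A^2 x <= 8 A] caused by the new weight. *)
have ax : 16 * A (s v) * (x + 1) <= 1.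
  by have := A1 (s v); rewrite (class_in_D1 _ vT) eqxx natrD.
have Ax : 0 <= A (s v) * x by rewrite mulr_ge0.
have A'1 i : 16 * A' i * (class_in (T :\ v) i)%:R <= 1.
  rewrite /A'; have [->|iv] := eqVneq i (s v).
    rewrite -/x; apply: le_trans (ax).
    have : A (s v) * (16 * A (s v) * (x + 1)) <= A (s v) * 1 by exact: (ler_wpM2l
      Asv0 ax).
    have : 0 <= A (s v) * A (s v) by rewrite mulr_ge0.
    by lra.
  by have := A1 i; rewrite (class_in_D1 _ vT) eq_sym (negPf iv) addn0.
apply: le_trans (ler_wpM2r (expR_ge0 _) (IH _ _ Tv A'0 A'1)) _.
rewrite -mulrA -expRD ler_wpM2l ?exprn_ge0 ?ler0n// ler_expR.
rewrite (bigD1 (s v))//= [X in _ <= 2 * X](bigD1 (s v))//=.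
rewrite (eq_bigr (fun i => A i * (class_in T i)%:R)); last first.
  move=> i iv; rewrite /A' (negPf iv) (class_in_D1 _ vT).
  by rewrite eq_sym (negPf iv) addn0.
rewrite /A' eqxx (class_in_D1 _ vT) eqxx natrD -/x.
set Z := \sum_(i | _) _.
rewrite /=.
(* This gives [16 A^2 x <= A], hence [2 A (1 + 8 A) x + A <= 2 A (x + 1)]. *)
have : A (s v) * (16 * A (s v) * (x + 1)) <= A (s v) * 1 by exact: (ler_wpM2l
  Asv0 ax).
have : 0 <= A (s v) * A (s v) by rewrite mulr_ge0.
by lra.
Qed.

End ColorDeviation.

(** * The random hypergraph as a product measure, and the weighted second moment bound *)

Section SecondMoment.
Variables (R : realType) (n k : nat) (p : R).
Hypothesis p01 : 0 <= p <= 1.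
Implicit Types (E : hypergraph 'I_n) (h : {set 'I_n} -> R).

(** Independence of the edges: expanding the product of [F + G], a hypergraph chooses [F] for its
    edges and [G] for its non-edges. Sets of size other than [k] have [F = 0] and [G = 1], which
    removes the nonuniform hypergraphs. *)
Lemma sum_Hnkp_mass_prod h :
  \sum_(E : hypergraph 'I_n) Hnkp_mass k p E * \prod_(e in E) h e =
  \prod_(e : {set 'I_n} | #|e| == k) (1 - p + p * h e).
Proof.
pose F (e : {set 'I_n}) : R := if #|e| == k then p * h e else 0.
pose G (e : {set 'I_n}) : R := if #|e| == k then 1 - p else 1.
rewrite [RHS]big_mkcond /=.
have -> : \prod_(e : {set 'I_n}) (if #|e| == k then 1 - p + p * h e else 1) =
    \prod_(e : {set 'I_n}) (F e + G e).
  by apply: eq_bigr => e _; rewrite /F /G; case: ifP; rewrite ?add0r// addrC.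
rewrite bigA_distr; apply: eq_bigr => E _; rewrite /Hnkp_mass.
case: ifPn => [/forall_inP uE|].
  rewrite big_mkcond [X in _ * X]big_mkcond -big_split /=; apply: eq_bigr => e _.
  rewrite /F /G; case: ifPn => ke; case: ifPn => eE; rewrite ?mulr1 ?mul1r//.
  by rewrite uE in ke.
move=> /forall_inPn[e eE ke].
by rewrite mul0r (bigD1 e)//= eE /F (negPf ke) mul0r.
Qed.

Lemma sum_Hnkp_mass : \sum_(E : hypergraph 'I_n) Hnkp_mass k p E = 1.
Proof.
transitivity (\sum_(E : hypergraph 'I_n) Hnkp_mass k p E * \prod_(e in E) 1).
  by apply: eq_bigr => E _; rewrite big1 ?mulr1.
by rewrite sum_Hnkp_mass_prod big1// => e _; rewrite mulr1 subrK.
Qed.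

Lemma Hnkp_mass_ge0 E : 0 <= Hnkp_mass k p E.
Proof.
rewrite /Hnkp_mass; case: ifP => // _; apply: prodr_ge0 => e _.
by case/andP: p01 => p0 p1; case: ifP; rewrite ?subr_ge0.
Qed.

Lemma Hnkp_prob_le1 (A : pred (hypergraph 'I_n)) : Hnkp_prob k p A <= 1.
Proof.
rewrite -sum_Hnkp_mass /Hnkp_prob [leRHS](bigID A)/= lerDl.
by apply: sumr_ge0 => E _; exact: Hnkp_mass_ge0.
Qed.

Variable r : nat.
Implicit Types (c d : {ffun 'I_n -> 'I_r}).

(* As [2 x - x ^ 2] is at most [1] and vanishes at [0], it bounds the indicator
   of colorability from below for every [x] supported on colorable hypergraphs. *)
Lemma Hnkp_prob_colorable_ge (B : {set {ffun 'I_n -> 'I_r}})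
    (h : {ffun 'I_n -> 'I_r} -> {set 'I_n} -> R)
    (z := fun c => \prod_(e : {set 'I_n} | #|e| == k) (1 - p + p * h c e)) :
  (0 < #|B|)%N -> (forall c e, monochromatic c e -> h c e = 0) ->
  (forall c, z c != 0) ->
  2 - #|B|%:R ^- 2 * \sum_(c in B) \sum_(d in B)
      \prod_(e : {set 'I_n} | #|e| == k)
        ((1 - p + p * (h c e * h d e)) /
         ((1 - p + p * h c e) * (1 - p + p * h d e)))
  <= Hnkp_prob k p (@colorable 'I_n r).
Proof.
move=> B0 hmono z0.
have b0 : #|B|%:R != 0 :> R by rewrite pnatr_eq0 -lt0n.
(* Each [z c] is the mean of the product it divides, so [x] has mean one. *)
pose x E := #|B|%:R^-1 * \sum_(c in B) (\prod_(e in E) h c e) / z c.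
have x0 E : ~~ colorable r E -> x E = 0.
  move=> nE; rewrite /x big1 ?mulr0// => c _.
  suff [e eE /hmono hce] : exists2 e, e \in E & monochromatic c e.
    by rewrite (bigD1 e)//= hce !mul0r.
  move: nE; rewrite negb_exists => /forallP/(_ c).
  by rewrite negb_forall_in => /exists_inP[e eE]; rewrite negbK; exists e.
have Ex : \sum_E Hnkp_mass k p E * x E = 1.
  rewrite /x; under eq_bigr => E _ do rewrite mulrCA mulr_sumr.
  rewrite -mulr_sumr exchange_big /=.
  rewrite (eq_bigr (fun=> 1)) ?sumr_const ?mulVf//.
  move=> c _; under eq_bigr => E _ do rewrite mulrA.
  by rewrite -mulr_suml sum_Hnkp_mass_prod -/(z c) divff.
have Ex2 : \sum_E Hnkp_mass k p E * x E ^+ 2 =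
    #|B|%:R ^- 2 * \sum_(c in B) \sum_(d in B)
      \prod_(e : {set 'I_n} | #|e| == k)
        ((1 - p + p * (h c e * h d e)) /
         ((1 - p + p * h c e) * (1 - p + p * h d e))).
  have sq E : x E ^+ 2 = #|B|%:R ^- 2 * \sum_(c in B) \sum_(d in B)
      (\prod_(e in E) (h c e * h d e)) / (z c * z d).
    rewrite /x exprMn exprVn; congr (_ * _).
    rewrite expr2 mulr_suml; apply: eq_bigr => c _.
    rewrite mulr_sumr; apply: eq_bigr => d _.
    by rewrite big_split /= invfM mulrACA.
  under eq_bigr => E _ do rewrite sq mulrCA.
  rewrite -mulr_sumr; congr (_ * _).
  under eq_bigr => E _ do rewrite mulr_sumr.
  rewrite exchange_big; apply: eq_bigr => c _.
  under eq_bigr => E _ do rewrite mulr_sumr.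
  rewrite exchange_big; apply: eq_bigr => d _.
  under eq_bigr => E _ do rewrite mulrA.
  by rewrite -mulr_suml sum_Hnkp_mass_prod big_split /= prodfV big_split.
rewrite -Ex2 /Hnkp_prob.
have -> : (2 : R) = \sum_E Hnkp_mass k p E * (2 * x E).
  by under eq_bigr => E _ do rewrite mulrCA; rewrite -mulr_sumr Ex mulr1.
rewrite -sumrB [leRHS]big_mkcond; apply: ler_sum => E _.
rewrite -mulrBr; case: ifPn => [_|/x0->]; last by rewrite mulr0 expr0n subrr mulr0.
rewrite -[leRHS]mulr1 ler_wpM2l ?Hnkp_mass_ge0//.
by have := sqr_ge0 (x E - 1); nra.
Qed.

End SecondMoment.

(** * The factor of a single potential edge in the second moment *)

Section EdgeRatio.
Variable R : realType.

(** The booleans tell whether the edge is monochromatic for the first and for the second coloring.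
    By [1 + y <= exp y] each of the four cases becomes a polynomial inequality, and [2 p^2] absorbs
    the errors of second order in [p]. *)
Lemma edge_ratio_le (p w : R) (s t : bool) : 0 <= p <= 1 / 2 -> 1 <= w <= 2 ->
  (1 - p + p * ((w * (~~ s)%:R) * (w * (~~ t)%:R))) /
  ((1 - p + p * (w * (~~ s)%:R)) * (1 - p + p * (w * (~~ t)%:R))) <=
  expR (p * ((w - 1) ^+ 2 - (s%:R + t%:R) * (w * (w - 1)) + (s && t)%:R * w ^+ 2)
        + 2 * p ^+ 2).
Proof.
move=> /andP[p0 p2] /andP[w1 w2].
pose q := p * (w - 1).
have q0 : 0 <= q by rewrite mulr_ge0 ?subr_ge0.
have qp : q <= p by rewrite /q -[leRHS]mulr1 ler_wpM2l//; lra.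
have p20 := sqr_ge0 p.
have le_expR y x d : 0 < d -> x <= (1 + y) * d -> x / d <= expR y :> R.
  move=> d0 xd; rewrite ler_pdivrMr//; apply: le_trans xd _.
  by rewrite ler_wpM2r ?(ltW d0) ?expR_ge1Dx.
have one : (1 - p) / ((1 - p) * (1 + q)) <= expR (- q + 2 * p ^+ 2).
  apply: le_expR; first by rewrite mulr_gt0//; lra.
  rewrite mulrCA -[leLHS]mulr1 ler_wpM2l//; first by lra.
  have : 0 <= q * (p - q) by rewrite mulr_ge0// subr_ge0.
  have : 0 <= p * (p - q) by rewrite mulr_ge0// subr_ge0.
  have : 0 <= q * p ^+ 2 by rewrite mulr_ge0.
  by have := sqr_ge0 q; rewrite !expr2; lra.
case: s; case: t => /=; rewrite ?mulr0 ?mulr1 ?addr0 ?mul0r ?mul1r ?mulr0 ?addr0.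
- apply: le_expR; first by rewrite mulr_gt0//; lra.
  have : 0 <= p ^+ 2 * (1 - 2 * p) by rewrite mulr_ge0//; lra.
  have : 0 <= (1 - p) * (p ^+ 2 * (1 - 2 * p)).
    by rewrite !mulr_ge0//; lra.
  by rewrite !expr2; lra.
- rewrite (_ : 1 - p + p * w = 1 + q); last by rewrite /q; ring.
  rewrite (_ : p * _ = - q)//; by rewrite /q; ring.
- rewrite (_ : 1 - p + p * w = 1 + q); last by rewrite /q; ring.
  rewrite [_ * (1 - p)]mulrC (_ : p * _ = - q)//; by rewrite /q; ring.
- rewrite (_ : 1 - p + p * w = 1 + q); last by rewrite /q; ring.
  apply: le_expR; first by rewrite mulr_gt0//; lra.
  have -> : 1 - p + p * (w * w) = 1 + p * (w - 1) ^+ 2 + 2 * q by rewrite /q; ring.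
  rewrite subr0; set a := p * (w - 1) ^+ 2.
  have a0 : 0 <= a by rewrite /a mulr_ge0 ?sqr_ge0.
  have := mulr_ge0 a0 q0; have := mulr_ge0 (mulr_ge0 a0 q0) q0.
  have : 0 <= p ^+ 2 * ((1 + q) * (1 + q)) by rewrite !mulr_ge0//; lra.
  by have := sqr_ge0 q; rewrite !expr2; lra.
Qed.

End EdgeRatio.

(** * Counting monochromatic [k]-sets through class and cell sizes *)

Section MonochromaticCount.
Variables (R : realType) (V : finType) (k : nat).
Hypothesis k0 : (0 < k)%N.

(** A nonempty set lies in at most one color class; the empty set would be counted once per
    color. *)
Lemma natr_monochromatic r (c : {ffun V -> 'I_r}) (e : {set V}) : #|e| == k ->
  (monochromatic c e)%:R = \sum_(i < r) (e \subset [set v | c v == i])%:R :> R.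
Proof.
move=> /eqP ek; have /card_gt0P[v ve] : (0 < #|e|)%N by rewrite ek.
have sub i : (e \subset [set v | c v == i]) = [forall v in e, c v == i].
  apply/fintype.subsetP/forall_inP => h x xe; first by have := h x xe; rewrite inE.
  by rewrite inE h.
rewrite (bigD1 (c v))//= big1 ?addr0 => [|i iv]; last first.
  have [/fintype.subsetP/(_ v ve)|//] := boolP (_ \subset _).
  by rewrite inE eq_sym (negPf iv).
congr (nat_of_bool _)%:R; rewrite sub; apply/existsP/idP => [[i /forall_inP ci]|cv].
  by apply/forall_inP => x xe; rewrite (eqP (ci x xe)) (eqP (ci v ve)).
by exists (c v).
Qed.

Lemma sum_subset_card (A : {set V}) :
  \sum_(e : {set V} | #|e| == k) (e \subset A)%:R = 'C(#|A|, k)%:R :> R.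
Proof.
rewrite -cards_draws -sum1_card natr_sum big_mkcond [RHS]big_mkcond /=.
by apply: eq_bigr => e _; rewrite inE andbC; case: (#|e| == k); case: (e \subset A).
Qed.

Lemma sum_monochromatic r (c : {ffun V -> 'I_r}) :
  \sum_(e : {set V} | #|e| == k) (monochromatic c e)%:R =
  \sum_(i < r) 'C(#|[set v | c v == i]|, k)%:R :> R.
Proof.
rewrite (eq_bigr _ (fun e => @natr_monochromatic r c e)) exchange_big /=.
by apply: eq_bigr => i _; rewrite sum_subset_card.
Qed.

Lemma sum_monochromatic2 r (c d : {ffun V -> 'I_r}) :
  \sum_(e : {set V} | #|e| == k) (monochromatic c e && monochromatic d e)%:R =
  \sum_(i < r) \sum_(j < r) 'C(#|[set v | (c v == i) && (d v == j)]|, k)%:R :> R.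
Proof.
transitivity (\sum_(e : {set V} | #|e| == k) \sum_(i < r) \sum_(j < r)
    (e \subset [set v | (c v == i) && (d v == j)])%:R : R).
  apply: eq_bigr => e ek; rewrite -mulnb natrM !natr_monochromatic// mulr_suml.
  apply: eq_bigr => i _; rewrite mulr_sumr; apply: eq_bigr => j _.
  rewrite -natrM mulnb -finset.subsetI.
  suff -> : [set v | c v == i] :&: [set v | d v == j] =
            [set v | (c v == i) && (d v == j)] by [].
  by apply/setP => v; rewrite !inE.
rewrite exchange_big; apply: eq_bigr => i _.
rewrite exchange_big; apply: eq_bigr => j _.
exact: sum_subset_card.
Qed.

End MonochromaticCount.

(** * Comparison of binomial coefficients with powers *)

Section BinomialBounds.
Variable R : realType.

Lemma subn_expn_le_ffact (t k j : nat) : (j <= k)%N -> ((t - k) ^ j <= t ^_ j)%N.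
Proof.
elim: j => // j IH jk; rewrite expnSr ffactnSr leq_mul ?IH ?(ltnW jk)//.
by rewrite leq_sub2l// ltnW.
Qed.

Lemma ffact_le_expn (t j : nat) : (t ^_ j <= t ^ j)%N.
Proof. by elim: j => // j IH; rewrite expnSr ffactnSr leq_mul ?leq_subr. Qed.

Lemma binM_fact_le (t k : nat) : 'C(t, k)%:R * k`!%:R <= t%:R ^+ k :> R.
Proof. by rewrite -natrM bin_ffact -natrX ler_nat ffact_le_expn. Qed.

(** The falling factorial is at least [(t - k)^k] with truncated subtraction, which is then bounded
    by its tangent at [z]. The result is linear in [t], so its sum over color classes depends only
    on their total size. *)
Lemma binM_fact_ge_tangent (t k : nat) (z : R) : 0 <= z ->
  z ^+ k + k%:R * z ^+ k.-1 * (t%:R - k%:R - z) <= 'C(t, k)%:R * k`!%:R.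
Proof.
move=> z0; apply: le_trans (_ : (t - k)%:R ^+ k <= _); last first.
  by rewrite -natrM bin_ffact -natrX ler_nat subn_expn_le_ffact.
apply: le_trans (tangent_le_exprn k _ z0) => //.
rewrite lerD2l ler_wpM2l ?mulr_ge0 ?exprn_ge0 ?ler0n// lerB//.
by rewrite lerBlDr -natrD ler_nat addnC -leq_subLR.
Qed.

End BinomialBounds.

(** * The exponent contributed by a pair of colorings *)

Section ColoringPair.
Variables (R : realType) (n r m : nat).
Local Notation k := m.+2.
Hypothesis r2 : (2 <= r)%N.
Implicit Types c d : {ffun 'I_n -> 'I_r}.

Definition class_size c (i : 'I_r) := #|[set v | c v == i]|.

Definition cell_size c d (i j : 'I_r) := #|[set v | (c v == i) && (d v == j)]|.

Lemma sum_class_size c : (\sum_i class_size c i = n)%N.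
Proof.
rewrite -[RHS]card_ord -sum1_card (partition_big c xpredT)//=.
by apply: eq_bigr => i _; rewrite /class_size -sum1_card; apply: eq_bigl => v;
  rewrite inE.
Qed.

Lemma sum_cell_size c d i : (\sum_j cell_size c d i j = class_size c i)%N.
Proof.
rewrite /class_size -sum1_card (partition_big d xpredT)//=.
apply: eq_bigr => j _; rewrite /cell_size -sum1_card.
by apply: eq_bigl => v; rewrite !inE.
Qed.

Lemma cell_size_le c d i j : (cell_size c d i j <= class_size c i)%N.
Proof. by rewrite -(sum_cell_size c d i) (bigD1 j)//= leq_addr. Qed.

(** The probability that a uniform coloring makes a given [k]-set monochromatic. *)
Definition inv_u : R := r%:R^-1 ^+ m.+1.

Let r0 : (r%:R : R) != 0.
Proof. by rewrite pnatr_eq0; case: r r2. Qed.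

Definition taylor_excess c d : R :=
  \sum_i \sum_j ((cell_size c d i j)%:R ^+ k -
    (((class_size c i)%:R / r%:R) ^+ k + k%:R * ((class_size c i)%:R / r%:R) ^+ m.+1
      * ((cell_size c d i j)%:R - (class_size c i)%:R / r%:R))).

(** Within a class the deviations of the cells from their mean sum to zero, so the linear terms
    cancel, and the constant terms give [r (s / r)^k = s^k / u] for a class of size [s]. *)
Lemma sum_cell_size_exprn c d :
  \sum_i \sum_j (cell_size c d i j)%:R ^+ k =
  taylor_excess c d + inv_u * \sum_i (class_size c i)%:R ^+ k.
Proof.
rewrite /taylor_excess mulr_sumr -big_split; apply: eq_bigr => i _ /=.
rewrite sumrB; set z := _ / r%:R.
suff -> : \sum_j (z ^+ k + k%:R * z ^+ m.+1 * ((cell_size c d i j)%:R - z)) =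
    inv_u * (class_size c i)%:R ^+ k by rewrite subrK.
rewrite big_split /= -[X in _ + X]mulr_sumr sumrB -natr_sum sum_cell_size
  !sumr_const card_ord.
have rz : r%:R * z = (class_size c i)%:R by rewrite /z mulrC divfK.
rewrite -[z *+ r]mulr_natl rz subrr mulr0 addr0 -[_ *+ r]mulr_natl.
rewrite /z expr_div_n /inv_u exprVn [r%:R ^+ k]exprS.
by field; rewrite expf_neq0 r0.
Qed.

(** The total and the cells are bounded above by powers. For [c] the tangent is taken at each class
    size itself, for [d] at the common mean [n / r]. All terms of degree [k] outside the Taylor
    excess then cancel, and two corrections of degree [k - 1] remain. *)
Lemma pair_excess_le c d :
  (inv_u ^+ 2 * 'C(n, k)%:R - inv_u * (\sum_i 'C(class_size c i, k)%:R)
   - inv_u * (\sum_i 'C(class_size d i, k)%:R)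
   + \sum_i \sum_j 'C(cell_size c d i j, k)%:R) * k`!%:R <=
  taylor_excess c d + inv_u * k%:R ^+ 2 * \sum_i (class_size c i)%:R ^+ m.+1
  + inv_u ^+ 2 * r%:R * k%:R ^+ 2 * n%:R ^+ m.+1.
Proof.
have b0 : 0 <= inv_u by rewrite exprn_ge0// invr_ge0.
have hN := ler_wpM2l (sqr_ge0 inv_u) (binM_fact_le R n k).
have hx : (\sum_i \sum_j 'C(cell_size c d i j, k)%:R) * k`!%:R <=
    taylor_excess c d + inv_u * \sum_i (class_size c i)%:R ^+ k.
  rewrite -sum_cell_size_exprn mulr_suml; apply: ler_sum => i _.
  by rewrite mulr_suml; apply: ler_sum => j _; exact: binM_fact_le.
have hc : \sum_i (class_size c i)%:R ^+ k -
    k%:R ^+ 2 * \sum_i (class_size c i)%:R ^+ m.+1 <=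
    (\sum_i 'C(class_size c i, k)%:R) * k`!%:R :> R.
  rewrite mulr_sumr mulr_suml -sumrB; apply: ler_sum => i _.
  apply: le_trans (binM_fact_ge_tangent _ _ (ler0n R (class_size c i))).
  by rewrite le_eqVlt; apply/orP; left; apply/eqP => /=; ring.
have hd : inv_u * n%:R ^+ k - inv_u * r%:R * k%:R ^+ 2 * n%:R ^+ m.+1 <=
    (\sum_i 'C(class_size d i, k)%:R) * k`!%:R :> R.
  have z0 : 0 <= n%:R / r%:R :> R by rewrite divr_ge0.
  rewrite mulr_suml.
  apply: le_trans (ler_sum _ (fun i _ => binM_fact_ge_tangent (class_size d i) k
    z0)).
  rewrite big_split /= -[X in _ <= _ + X]mulr_sumr !sumrB -natr_sum
    sum_class_size !sumr_const card_ord.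
  set z := n%:R / r%:R.
  rewrite -[z ^+ k *+ r]mulr_natl -[k%:R *+ r]mulr_natl -[z *+ r]mulr_natl.
  have rz : r%:R * z = n%:R :> R by rewrite /z mulrC divfK.
  have zm : z ^+ m.+1 = inv_u * n%:R ^+ m.+1 :> R.
    by rewrite /z expr_div_n /inv_u exprVn mulrC.
  rewrite rz [z ^+ k]exprS mulrA rz zm [n%:R ^+ k]exprS.
  set y := n%:R ^+ m.+1; set K := k%:R.
  by rewrite le_eqVlt; apply/orP; left; apply/eqP; ring.
have := ler_wpM2l b0 hc; have := ler_wpM2l b0 hd.
have e : inv_u ^+ 2 = inv_u * inv_u by rewrite expr2.
move: hN hx; rewrite e; set X := taylor_excess c d.
set s1 := \sum_i (class_size c i)%:R ^+ k.
set s2 := \sum_i (class_size c i)%:R ^+ m.+1.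
set nk := n%:R ^+ k; set nm := n%:R ^+ m.+1.
set f := k`!%:R. set a' := \sum_i _. set b' := \sum_i _. set c' := \sum_i _.
set K := k%:R.
lra.
Qed.

Lemma edge_exponent_sum c d (p : R) (w := (1 - inv_u)^-1) : 1 - inv_u != 0 ->
  \sum_(e : {set 'I_n} | #|e| == k)
    (p * ((w - 1) ^+ 2 -
        ((monochromatic c e)%:R + (monochromatic d e)%:R) * (w * (w - 1)) +
        (monochromatic c e && monochromatic d e)%:R * w ^+ 2) + 2 * p ^+ 2) =
  p * w ^+ 2 *
  (inv_u ^+ 2 * 'C(n, k)%:R - inv_u * (\sum_i 'C(class_size c i, k)%:R)
   - inv_u * (\sum_i 'C(class_size d i, k)%:R)
   + \sum_i \sum_j 'C(cell_size c d i j, k)%:R) + 2 * p ^+ 2 * 'C(n, k)%:R.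
Proof.
(* The weight [w] is chosen for this identity, which lets [w^2] be factored out of every term. *)
move=> b1; have w1 : w - 1 = inv_u * w by rewrite /w; field.
have sumN (x : R) : \sum_(e : {set 'I_n} | #|e| == k) x = 'C(n, k)%:R * x.
  rewrite sumr_const -[in RHS](card_ord n) -[in RHS]cardsT -cards_draws mulr_natl.
  by congr (_ *+ _); apply: eq_card => e; rewrite !inE finset.subsetT.
rewrite big_split sumN /= -mulr_sumr w1.
rewrite big_split sumrB /= sumN -!mulr_suml big_split /=.
rewrite !sum_monochromatic// sum_monochromatic2//.
rewrite -/(class_size c _) -/(class_size d _).
by rewrite /class_size /cell_size; ring.
Qed.

End ColoringPair.

(** * Estimates for fixed [n], with [a = k r] as the large parameter and errors of order [1 / a] *)

Section CoreEstimate.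
Variables (R : realType) (n r m : nat).
Local Notation k := m.+2.
Local Notation a := (k%:R * r%:R : R).
Local Notation u := (r%:R ^+ m.+1 : R).
Local Notation n' := (n%:R : R).
Local Notation r' := (r%:R : R).
Local Notation k' := (k%:R : R).
Hypothesis r2 : (2 <= r)%N.
Hypothesis k_ge : (128 * 128 <= k)%N.
Hypothesis u_ge : ((k * r) ^ 16 <= r ^ m.+1)%N.
Hypothesis n_ge : ((r ^ m.+1) ^ 2 <= n)%N.
Implicit Types c d : {ffun 'I_n -> 'I_r}.

Lemma natr_r_ge : 2 <= r'. Proof. by rewrite (ler_nat _ 2). Qed.

Lemma natr_k_ge : 128 * 128 <= k'.
Proof. by rewrite -(natrM _ 128 128) ler_nat. Qed.

Lemma a_ge : 256 * 128 <= a.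
Proof.
have := natr_r_ge; have := natr_k_ge; move: k' r' => x y hx hy.
have : 128 * 128 * y <= x * y by rewrite ler_wpM2r//; lra.
lra.
Qed.

Lemma a_gt0 : 0 < a. Proof. by have := a_ge; lra. Qed.

Lemma a_exp_le_u : a ^+ 16 <= u.
Proof. by rewrite -natrM -!natrX ler_nat. Qed.

Lemma u_sqr_le_n : u ^+ 2 <= n'.
Proof. by rewrite -!natrX ler_nat. Qed.

Lemma a_exp_mono i j : (i <= j)%N -> a ^+ i <= a ^+ j.
Proof. by apply: ler_weXn2l; have := a_ge; lra. Qed.

Lemma a_exp_le_n i : (i <= 32)%N -> a ^+ i <= n'.
Proof.
move=> i32; apply: le_trans u_sqr_le_n; apply: le_trans (a_exp_mono i32) _.
have e : a ^+ 32 = (a ^+ 16) ^+ 2 by rewrite -exprM.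
rewrite e lerXn2r ?nnegrE ?exprn_ge0 ?ler0n ?mulr_ge0 ?ler0n//.
exact: a_exp_le_u.
Qed.

Lemma u_gt0 : 0 < u.
Proof. by rewrite exprn_gt0//; have := natr_r_ge; lra. Qed.

Lemma n_gt0 : 0 < n'.
Proof. by apply: lt_le_trans (a_exp_le_n (leq0n 32)); rewrite expr0. Qed.

Lemma k_le_a : k' <= a.
Proof. by rewrite -[leLHS]mulr1 ler_wpM2l ?ler0n//; have := natr_r_ge; lra. Qed.

Lemma r_le_a : r' <= a.
Proof. by rewrite -[leLHS]mul1r ler_wpM2r ?ler0n//; have := natr_k_ge; lra. Qed.

(** The ratio of the [m]-th power of [4/3] of the mean cell size to that of the class size. *)
Definition decay : R := (4 / (3 * r')) ^+ m.

Lemma decay_ge0 : 0 <= decay.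
Proof. by rewrite exprn_ge0// divr_ge0// mulr_ge0 ?ler0n. Qed.

(** The threshold [4/3] works because [(4/3)^2 <= 2 <= r], so each factor of [decay], once squared,
    is at most [1 / r]. *)
Lemma decay_sqr_le : decay ^+ 2 <= r' / u.
Proof.
have r0 : 0 < r' by have := natr_r_ge; lra.
have -> : r' / u = r'^-1 ^+ m.
  by rewrite exprS exprVn invfM mulrA divff ?mul1r ?gt_eqF.
rewrite /decay exprAC lerXn2r ?nnegrE ?sqr_ge0 ?invr_ge0 ?(ltW r0)//.
have -> : (4 / (3 * r')) ^+ 2 = (16 / 9 / r') / r'.
  by field; rewrite gt_eqF.
rewrite ler_pdivrMr// mulVf ?gt_eqF// ler_pdivrMr// mul1r.
by have := natr_r_ge; lra.
Qed.

Lemma a_decay_le : a * decay <= a^-1.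
Proof.
have a0 := a_gt0.
rewrite -ler_sqr ?nnegrE ?mulr_ge0 ?decay_ge0 ?invr_ge0 ?ler0n//.
rewrite exprMn; apply: le_trans (ler_wpM2l (sqr_ge0 _) decay_sqr_le) _.
rewrite mulrA ler_pdivrMr ?u_gt0// exprVn [leRHS]mulrC ler_pdivlMr ?exprn_gt0//.
apply: le_trans a_exp_le_u.
apply: le_trans (_ : a ^+ 2 * a * a ^+ 2 <= _).
  by rewrite ler_wpM2r ?sqr_ge0// ler_wpM2l ?sqr_ge0// r_le_a.
by rewrite -exprSr -exprD a_exp_mono.
Qed.

Lemma k_sqr_decay_le : k' ^+ 2 * decay <= 16.
Proof.
have h : k' ^+ 2 * decay <= a * (a * decay).
  rewrite mulrA -expr2 ler_wpM2r ?decay_ge0// lerXn2r ?nnegrE ?mulr_ge0 ?ler0n//.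
  exact: k_le_a.
apply: le_trans h _; apply: le_trans (ler_wpM2l (ltW a_gt0) a_decay_le) _.
by rewrite divff ?gt_eqF ?a_gt0//; lra.
Qed.

Lemma expr_1_inv_k_le (j : nat) : (j <= k)%N -> (1 + k'^-1) ^+ j <= 4.
Proof.
move=> jk; apply: le_trans (_ : expR 1 <= _); last first.
  by apply: le_trans (@expR_le_quadratic R 1 _) _; lra.
have k0 : 0 < k' by rewrite ltr0n.
apply: le_trans (_ : expR k'^-1 ^+ j <= _).
  by rewrite lerXn2r ?nnegrE ?expR_ge0 ?expR_ge1Dx// addr_ge0// invr_ge0 ltW.
by rewrite -expRM_natl ler_expR ler_pdivrMr// mul1r ler_nat.
Qed.

(** * Balanced colorings, and the Taylor excess for near and far pairs *)

Definition max_size : R := (1 + k'^-1) * (n' / r').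

(** The relative tolerance [1 / k] costs only a bounded factor in powers of class sizes up to the
    [k]-th. *)
Definition balanced c :=
  [forall i, `|(class_size c i)%:R - n' / r'| <= n' / r' / k'].

Lemma balanced_le c i : balanced c -> (class_size c i)%:R <= max_size.
Proof.
move=> /forallP/(_ i); rewrite ler_norml => /andP[_].
by rewrite lerBlDl /max_size mulrDl mul1r [k'^-1 * _]mulrC.
Qed.

Lemma max_size_ge0 : 0 <= max_size.
Proof.
by rewrite mulr_ge0 ?addr_ge0 ?invr_ge0 ?divr_ge0 ?ler0n.
Qed.

Lemma max_size_le : max_size <= 2 * (n' / r').
Proof.
rewrite ler_wpM2r ?divr_ge0//; have := natr_k_ge.
move=> k1; have : k'^-1 <= 1 by rewrite invf_le1//; lra.
by move: k'^-1 => y; lra.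
Qed.

Lemma max_size_exp j : (j <= k)%N -> max_size ^+ j <= 4 * (n' / r') ^+ j.
Proof.
by move=> jk; rewrite exprMn ler_wpM2r ?exprn_ge0 ?divr_ge0// expr_1_inv_k_le.
Qed.

Lemma excess_le_near (x s : R) : 0 <= x <= 4 / 3 * (s / r') -> 0 <= s <= max_size ->
  x ^+ k - ((s / r') ^+ k + k' * (s / r') ^+ m.+1 * (x - s / r')) <=
  k' ^+ 2 * decay * max_size ^+ m * (x - s / r') ^+ 2.
Proof.
move=> /andP[x0 xs] /andP[s0 sS].
have r0 : 0 < r' by have := natr_r_ge; lra.
have sr : s / r' <= max_size / r' by rewrite ler_wpM2r ?invr_ge0 ?ler0n.
have sr0 : 0 <= s / r' by rewrite divr_ge0.
rewrite lerBlDl -[k' ^+ 2 * _ * _]mulrA /decay -exprMn.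
by apply: exprn_le_taylor2; apply/andP; split => //; rewrite invfM; lra.
Qed.

(** Beyond [4/3] of the mean [z], [x <= 4 (x - z)], which gives the factor 16 from two of the [k]
    powers of [x]; the tangent is nonnegative and is dropped. *)
Lemma excess_le_far (x s : R) : 4 / 3 * (s / r') < x -> 0 <= s -> x <= max_size ->
  x ^+ k - ((s / r') ^+ k + k' * (s / r') ^+ m.+1 * (x - s / r')) <=
  16 * max_size ^+ m * (x - s / r') ^+ 2.
Proof.
move=> xs s0 xS.
have z0 : 0 <= s / r' by rewrite divr_ge0 ?ler0n.
have x0 : 0 <= x by lra.
apply: le_trans (_ : x ^+ k <= _).
  rewrite lerBlDr lerDl addr_ge0 ?exprn_ge0// !mulr_ge0 ?exprn_ge0 ?ler0n//; lra.
have -> : x ^+ k = x ^+ 2 * x ^+ m by rewrite -exprD.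
rewrite [leRHS]mulrAC ler_pM ?sqr_ge0 ?exprn_ge0//; last first.
  by rewrite lerXn2r ?nnegrE ?max_size_ge0.
rewrite (_ : 16 * _ = (4 * (x - s / r')) ^+ 2); last by ring.
by rewrite lerXn2r ?nnegrE//; lra.
Qed.

Definition pair_sqdev c d : R := \sum_i sqdev R c [set: 'I_n] d i.

Lemma pair_sqdevE c d : pair_sqdev c d =
  \sum_i \sum_j ((cell_size c d i j)%:R - (class_size c i)%:R / r') ^+ 2.
Proof.
apply: eq_bigr => i _; apply: eq_bigr => j _; congr (_ ^+ 2).
rewrite /dev sumrB sumr_const card_ord; congr (_ - _).
  rewrite -natr_sum; congr _%:R; rewrite /cell_size -sum1_card big_mkcond.
  rewrite [RHS]big_mkcond; apply: eq_bigr => v _; rewrite !inE.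
  by case: (c v == i); case: (d v == j).
rewrite -[LHS]mulr_natl; congr (_%:R * _).
by rewrite /class_size; apply: eq_card => v; rewrite inE unfold_in finset.in_setT.
Qed.

Definition near_pair c d :=
  [forall i, [forall j, (cell_size c d i j)%:R <= 4 / 3 * ((class_size c i)%:R /
    r')]].

Lemma excess_near c d : balanced c -> near_pair c d ->
  taylor_excess R m c d <= k' ^+ 2 * decay * max_size ^+ m * pair_sqdev c d.
Proof.
move=> cB /forallP cd; rewrite pair_sqdevE mulr_sumr; apply: ler_sum => i _.
rewrite mulr_sumr; apply: ler_sum => j _; apply: excess_le_near.
  by rewrite ler0n; have /forallP/(_ j) := cd i.
by rewrite ler0n balanced_le.
Qed.

Lemma excess_any c d : balanced c ->
  taylor_excess R m c d <= 16 * max_size ^+ m * pair_sqdev c d.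
Proof.
move=> cB; rewrite pair_sqdevE mulr_sumr; apply: ler_sum => i _.
rewrite mulr_sumr; apply: ler_sum => j _.
have [h|h] := leP ((cell_size c d i j)%:R : R) (4 / 3 * ((class_size c i)%:R / r')).
  apply: le_trans (excess_le_near _ _) _; rewrite ?ler0n ?h ?balanced_le//.
  by rewrite ler_wpM2r ?sqr_ge0// ler_wpM2r ?exprn_ge0 ?max_size_ge0
    ?k_sqr_decay_le.
apply: excess_le_far; rewrite ?ler0n//.
by apply: le_trans (balanced_le i cB); rewrite ler_nat cell_size_le.
Qed.

(** One oversized cell suffices: balance makes its mean at least [n / (2 r^2)], and it exceeds that
    mean by more than a third. *)
Lemma sqdev_far c d : balanced c -> ~~ near_pair c d ->
  (n' / (6 * r' ^+ 2)) ^+ 2 <= pair_sqdev c d.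
Proof.
move=> cB; rewrite negb_forall => /existsP[i]; rewrite negb_forall => /existsP[j].
rewrite -ltNge => h; rewrite pair_sqdevE (bigD1 i)//= (bigD1 j)//= -addrA.
rewrite ler_wpDr//.
  rewrite addr_ge0 ?sumr_ge0// => *; rewrite ?sqr_ge0// sumr_ge0// => *.
  by rewrite sqr_ge0.
have r0 : 0 < r' by have := natr_r_ge; lra.
have n0 := n_gt0.
have hs : n' / r' / 2 <= (class_size c i)%:R.
  have /forallP/(_ i) := cB; rewrite ler_norml => /andP[h1 _].
  have hk : n' / r' / k' <= n' / r' / 2.
    rewrite ler_wpM2l ?divr_ge0// lef_pV2 ?posrE ?ltr0n// ler_nat.
    by apply: leq_trans k_ge; rewrite (@leq_mul 1 2).
  by move: h1 hk; move: (n' / r') (n' / r' / k') => y x; lra.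
have hz : n' / r' / 2 / r' <= (class_size c i)%:R / r'.
  by apply: ler_wpM2r hs; rewrite invr_ge0 ltW.
have e : n' / (6 * r' ^+ 2) = (n' / r' / 2 / r') / 3 by field; rewrite gt_eqF.
rewrite lerXn2r ?nnegrE ?divr_ge0 ?mulr_ge0 ?sqr_ge0//; last by rewrite e; lra.
have : 0 <= n' / r' / 2 / r' by rewrite !divr_ge0.
lra.
Qed.

(* An upper bound for [4 p / k!], hence for the weight [p w^2 / k!] of the Taylor
   excess in the exponent. *)
Definition rho : R := 4 * u / (k' * n' ^+ m.+1).

Lemma rho_ge0 : 0 <= rho.
Proof. by rewrite divr_ge0 ?mulr_ge0 ?exprn_ge0 ?ler0n. Qed.

Lemma rho_max_size_le : rho * max_size ^+ m <= 16 * r' / (k' * n').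
Proof.
have r0 : 0 < r' by have := natr_r_ge; lra.
have n0 := n_gt0; have k0 : k' != 0 by rewrite pnatr_eq0.
have mk : (m <= k)%N by rewrite (leq_trans (leqnSn m))// leqnSn.
apply: le_trans (ler_wpM2l rho_ge0 (max_size_exp mk)) _.
rewrite /rho expr_div_n !exprS le_eqVlt; apply/orP; left; apply/eqP.
move: (r' ^+ m) (n' ^+ m) (expf_neq0 m (lt0r_neq0 r0)) (expf_neq0 m (lt0r_neq0 n0)).
move: (lt0r_neq0 r0) (lt0r_neq0 n0) k0; move: r' n' k' => x y z x0 y0 z0 X Y X0 Y0.
by field; rewrite X0 Y0 y0 z0.
Qed.

Lemma rho_near_le : rho * (k' ^+ 2 * decay * max_size ^+ m) <= 16 / (a * n').
Proof.
have n0 := n_gt0; have a0 := a_gt0.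
have k0 : 0 < k' by rewrite ltr0n.
rewrite mulrCA; apply: le_trans (ler_wpM2l _ rho_max_size_le) _.
  by rewrite mulr_ge0 ?sqr_ge0 ?decay_ge0.
have -> : k' ^+ 2 * decay * (16 * r' / (k' * n')) = 16 / n' * (a * decay).
  move: (lt0r_neq0 n0) (lt0r_neq0 k0); move: n' k' => y z y0 z0.
  by field; rewrite y0 z0.
rewrite [(a * n')^-1]invfM [a^-1 * _]mulrC [leRHS]mulrA.
by rewrite ler_wpM2l ?divr_ge0 ?ler0n ?a_decay_le.
Qed.

Lemma rho_far_le : rho * (16 * max_size ^+ m) <= 256 * r' / (k' * n').
Proof.
rewrite mulrCA (_ : 256 * r' / (k' * n') = 16 * (16 * r' / (k' * n')));
  last by ring.
by rewrite ler_wpM2l ?rho_max_size_le.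
Qed.

(** * Averaging over the second coloring, and the number of balanced colorings *)

Lemma sum_expR_pair_sqdev c (A : R) : balanced c -> 0 <= A ->
  16 * A * max_size <= 1 ->
  \sum_d expR (A * pair_sqdev c d) <= r' ^+ n * expR (2 * A * n').
Proof.
move=> cB A0 A1.
have cs i : class_in c [set: 'I_n] i = class_size c i.
  by apply: eq_card => v; rewrite !inE.
have S : \sum_i A * (class_in c [set: 'I_n] i)%:R = A * n'.
  rewrite -mulr_sumr -natr_sum; congr (_ * _%:R).
  by rewrite -[RHS](sum_class_size c); apply: eq_bigr => i _; rewrite cs.
have := @sum_expR_sqdev R 'I_n 'I_r 'I_r c [set: 'I_n] (fun=> A) (fun=> A0).
rewrite S !card_ord mulrA => mgf.
rewrite (eq_bigr (fun d => expR (\sum_i A * sqdev R c [set: 'I_n] d i)));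
  last first.
  by move=> d _; rewrite -mulr_sumr.
apply: mgf => i; rewrite cs; apply: le_trans A1; rewrite ler_wpM2l ?mulr_ge0//.
exact: balanced_le.
Qed.

(** The first term is [1024 r / k], at most [1024 a], whereas the second is of order [n / (k r^3)],
    which is at least [a^2]. *)
Lemma far_exponent_le :
  4 * (256 * r' / (k' * n')) * n' -
  256 * r' / (k' * n') * (n' / (6 * r' ^+ 2)) ^+ 2 <= - a.
Proof.
have r0 : 0 < r' by have := natr_r_ge; lra.
have n0 := n_gt0; have k0 : 0 < k' by rewrite ltr0n.
have a0 := a_gt0; have aL := a_ge.
have -> : 4 * (256 * r' / (k' * n')) * n' = 1024 * (r' / k').
  by move: (lt0r_neq0 n0) (lt0r_neq0 k0); move: n' k' => y z y0 z0; field;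
    rewrite y0 z0.
have -> : 256 * r' / (k' * n') * (n' / (6 * r' ^+ 2)) ^+ 2 =
    64 / 9 * (n' / (k' * r' ^+ 3)).
  move: (lt0r_neq0 n0) (lt0r_neq0 k0) (lt0r_neq0 r0);
    move: n' k' r' => y z x y0 z0 x0.
  by field; rewrite y0 z0 x0.
have h1 : r' / k' <= a.
  rewrite ler_pdivrMr//.
  apply: le_trans r_le_a _; rewrite ler_peMr ?(ltW a0)//.
  by have := natr_k_ge; lra.
have h2 : a ^+ 2 <= n' / (k' * r' ^+ 3).
  rewrite ler_pdivlMr ?mulr_gt0 ?exprn_gt0//.
  apply: le_trans (_ : a ^+ 2 * (a * a ^+ 3) <= _); last first.
    by rewrite -exprS -exprD a_exp_le_n.
  rewrite ler_wpM2l ?sqr_ge0// ler_pM ?exprn_ge0 ?ler0n ?k_le_a//.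
  by rewrite lerXn2r ?nnegrE ?(ltW a0) ?ler0n ?r_le_a.
move: h1 h2 aL; move: (r' / k') (n' / (k' * r' ^+ 3)) a => x y z.
rewrite expr2 => h1 h2 z1.
have : 256 * 128 * z <= z * z by rewrite ler_wpM2r//; lra.
lra.
Qed.

Lemma sum_expR_excess c : balanced c ->
  \sum_d expR (rho * taylor_excess R m c d) <= r' ^+ n * (expR (32 / a) + a^-1).
Proof.
move=> cB.
have r0 : 0 < r' by have := natr_r_ge; lra.
have n0 := n_gt0; have k0 : 0 < k' by rewrite ltr0n.
have a0 := a_gt0.
pose A1 : R := 16 / (a * n').
pose A2 : R := 256 * r' / (k' * n').
pose t0 : R := (n' / (6 * r' ^+ 2)) ^+ 2.
have A10 : 0 <= A1 by rewrite divr_ge0 ?mulr_ge0 ?ler0n.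
have A20 : 0 <= A2 by rewrite divr_ge0 ?mulr_ge0 ?ler0n.
have D0 d : 0 <= pair_sqdev c d by apply: sumr_ge0 => i _; exact: sqdev_ge0.
(* For a far pair the squared deviation [D] is at least [t0], so [A2 D <= 2 A2 D - A2 t0]: doubling
   the weight buys the small factor [exp (- A2 t0)]. *)
have pw d : expR (rho * taylor_excess R m c d) <=
    expR (A1 * pair_sqdev c d) + expR (- (A2 * t0)) * expR (2 * A2 * pair_sqdev c
      d).
  have [cd|cd] := boolP (near_pair c d).
    rewrite ler_wpDr ?mulr_ge0 ?expR_ge0// ler_expR.
    apply: le_trans (ler_wpM2l rho_ge0 (excess_near cB cd)) _.
    by rewrite mulrA ler_wpM2r// rho_near_le.
  rewrite ler_wpDl ?expR_ge0// -expRD ler_expR.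
  apply: le_trans (ler_wpM2l rho_ge0 (excess_any d cB)) _.
  apply: le_trans (_ : A2 * pair_sqdev c d <= _).
    by rewrite mulrA ler_wpM2r// rho_far_le.
  have := ler_wpM2l A20 (sqdev_far cB cd); rewrite -/t0 -[2 * A2 * _]mulrA.
  by move: (A2 * t0) (A2 * pair_sqdev c d) => x y; lra.
apply: le_trans (ler_sum _ (fun d _ => pw d)) _.
rewrite big_split /= -mulr_sumr mulrDr lerD//.
  apply: le_trans (sum_expR_pair_sqdev cB A10 _) _.
    rewrite /A1; apply: le_trans (ler_wpM2l _ max_size_le) _.
      by rewrite mulr_ge0.
    rewrite (_ : _ * (2 * (n' / r')) = 512 / (a * r')); last first.
      move: (lt0r_neq0 n0) (lt0r_neq0 r0) (lt0r_neq0 k0).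
      by move: n' r' k' => y x z y0 x0 z0; field; rewrite y0 x0 z0.
    rewrite ler_pdivrMr ?mulr_gt0// mul1r.
    apply: le_trans _ (ler_wpM2l (ltW a0) natr_r_ge); have := a_ge; move: a => z;
      lra.
  rewrite ler_wpM2l ?exprn_ge0 ?ler0n// ler_expR /A1 le_eqVlt; apply/orP; left.
  apply/eqP; move: (lt0r_neq0 n0) (lt0r_neq0 a0); move: n' a => y z y0 z0.
  by field; rewrite y0 z0.
apply: le_trans (ler_wpM2l (expR_ge0 _) (sum_expR_pair_sqdev cB _ _)) _.
- by rewrite mulr_ge0.
- apply: le_trans (ler_wpM2l _ max_size_le) _; first by rewrite !mulr_ge0.
  (* The lower bound [128 * 128] on [k] makes the doubled weight admissible here. *)
  rewrite /A2 (_ : _ * (2 * (n' / r')) = 128 * 128 / k'); last first.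
    move: (lt0r_neq0 n0) (lt0r_neq0 r0) (lt0r_neq0 k0).
    by move: n' r' k' => y x z y0 x0 z0; field; rewrite y0 x0 z0.
  by rewrite ler_pdivrMr// mul1r natr_k_ge.
- rewrite mulrCA -expRD ler_wpM2l ?exprn_ge0 ?ler0n//.
  apply: le_trans (_ : expR (- a) <= _).
    rewrite ler_expR; apply: le_trans far_exponent_le; rewrite -/A2 -/t0.
    by rewrite (mulrA 2 2) addrC (_ : 2 * 2 = 4)//; lra.
  rewrite expRN lef_pV2 ?posrE ?expR_gt0//.
  by apply: le_trans (expR_ge1Dx a); lra.
Qed.

(** Markov's inequality for the exponential moment, with weight [1 / (16 n)]: the mean is at most
    [exp (1 / 8) <= 2], while an unbalanced coloring contributes at least [2 a]. *)
Lemma card_balanced_ge :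
  (1 - a^-1) * r' ^+ n <= #|[set c : {ffun 'I_n -> 'I_r} | balanced c]|%:R.
Proof.
have r0 : 0 < r' by have := natr_r_ge; lra.
have n0 := n_gt0; have k0 : 0 < k' by rewrite ltr0n.
have a0 := a_gt0.
pose A : R := (16 * n')^-1.
have A0 : 0 <= A by rewrite invr_ge0 mulr_ge0 ?ler0n.
(* With a single class, the cells are the color classes of the random coloring. *)
pose one (v : 'I_n) : 'I_1 := ord0.
have c1 i : class_in one [set: 'I_n] i = n.
  by rewrite -[RHS](card_ord n); apply: eq_card => v; rewrite !inE [i]ord1.
have := @sum_expR_sqdev R 'I_n 'I_r 'I_1 one [set: 'I_n] (fun=> A) (fun=> A0).
rewrite !card_ord big_ord1 c1 => mgf.
have {}mgf : \sum_(c : {ffun 'I_n -> 'I_r}) expR (A * sqdev R one [set: 'I_n] c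
  ord0)
    <= r' ^+ n * 2.
  rewrite (eq_bigr (fun c => expR (\sum_i A * sqdev R one [set: 'I_n] c i))).
    2: by move=> c _; rewrite big_ord1.
  apply: le_trans (mgf _) _.
    move=> i; rewrite c1 /A invfM mulrA divff ?mul1r ?mulVf ?gt_eqF//.
  rewrite ler_wpM2l ?exprn_ge0 ?ler0n//.
  rewrite (_ : A * n' = 16^-1); last first.
    by rewrite /A invfM divfK ?gt_eqF.
  by apply: le_trans (@expR_le_quadratic R _ _) _; lra.
have far c : ~~ balanced c -> 2 * a <= expR (A * sqdev R one [set: 'I_n] c ord0).
  rewrite negb_forall => /existsP[j]; rewrite -ltNge => h.
  have sq : (n' / r' / k') ^+ 2 <= sqdev R one [set: 'I_n] c ord0.
    rewrite /sqdev (bigD1 j)//= ler_wpDr ?sumr_ge0// => [i _|];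
      first by rewrite sqr_ge0.
    have -> : dev R one [set: 'I_n] c ord0 j = (class_size c j)%:R - n' / r'.
      rewrite /dev sumrB sumr_const card_ord; congr (_ - _).
        rewrite -natr_sum /class_size -sum1_card big_mkcond [in RHS]big_mkcond.
        by congr _%:R; apply: eq_bigr => v _; rewrite !inE; case: (c v == j).
      rewrite -[LHS]mulr_natl; congr (_%:R * _).
      by rewrite -[RHS](card_ord n); apply: eq_card => v;
        rewrite unfold_in finset.in_setT.
    rewrite -[leRHS]real_normK ?num_real// lerXn2r ?nnegrE ?normr_ge0 ?divr_ge0//.
    exact: ltW.
  apply: le_trans (expR_ge1Dx _); rewrite ler_wpDl//.
  apply: le_trans (ler_wpM2l A0 sq).
  have -> : A * (n' / r' / k') ^+ 2 = n' / (16 * a ^+ 2).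
    rewrite /A; move: (lt0r_neq0 n0) (lt0r_neq0 r0) (lt0r_neq0 k0).
    by move: n' r' k' => y x z y0 x0 z0; field; rewrite y0 x0 z0.
  rewrite ler_pdivlMr ?mulr_gt0 ?exprn_gt0//.
  apply: le_trans (_ : a ^+ 4 <= _); last exact: a_exp_le_n.
  rewrite (_ : 2 * a * _ = 32 * a ^+ 3); last by ring.
  rewrite [leRHS]exprS ler_wpM2r ?exprn_ge0 ?(ltW a0)//.
  by have := a_ge; lra.
pose B := [set c : {ffun 'I_n -> 'I_r} | balanced c].
have bad : 2 * a * #|~: B|%:R <= r' ^+ n * 2.
  apply: le_trans mgf; rewrite [leRHS](bigID (mem (~: B)))/= ler_wpDr//.
    by rewrite sumr_ge0// => *; rewrite expR_ge0.
  rewrite [leLHS]mulrC [leLHS]mulr_natl -[leLHS]sumr_const; apply: ler_sum => c.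
  by rewrite !inE => /far.
have tot : #|B|%:R + #|~: B|%:R = r' ^+ n :> R.
  by rewrite -natrD cardsC card_ffun !card_ord natrX.
rewrite -/B -tot; move: bad; rewrite -tot.
move: (#|B|%:R) (#|~: B|%:R) => x y; rewrite mulrAC => bad.
have {}bad : a * y <= x + y by lra.
have : y <= a^-1 * (x + y) by rewrite mulrC ler_pdivlMr// mulrC.
by rewrite mulrBl mul1r; move: (a^-1 * (x + y)) => w; lra.
Qed.

(** * The edge probability, and the colorability bound for fixed [n] *)

Variable p : R.
Hypothesis p_ge0 : 0 <= p.
Hypothesis p_le : p * 'C(n, k)%:R <= u * n' / (2 * k').

Lemma exprn_le_2bin : n' ^+ k <= 2 * ('C(n, k)%:R * k`!%:R).
Proof.
have := @binM_fact_ge_tangent R n k n' (ler0n R n).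
rewrite /= [n' ^+ k]exprS => h.
have kn : 2 * k' ^+ 2 <= n'.
  apply: le_trans (_ : a ^+ 3 <= _); last exact: a_exp_le_n.
  rewrite [a ^+ 3]exprS ler_pM ?sqr_ge0//; first by have := a_ge; lra.
  by rewrite lerXn2r ?nnegrE ?(ltW a_gt0) ?ler0n ?k_le_a.
have := ler_wpM2r (exprn_ge0 m.+1 (ltW n_gt0)) kn.
move: h; move: ('C(n, k)%:R * k`!%:R) (n' ^+ m.+1) => x y.
by move: n' k' => z w; rewrite expr2; lra.
Qed.

Lemma four_p_le : 4 * p <= k`!%:R * rho.
Proof.
have n0 := n_gt0; have k0 : 0 < k' by rewrite ltr0n.
have f0 : 0 <= k`!%:R :> R by rewrite ler0n.
have h1 : p * n' ^+ k <= k`!%:R * (u * n' / k').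
  apply: le_trans (ler_wpM2l p_ge0 exprn_le_2bin) _.
  have := ler_wpM2l f0 p_le; rewrite invfM.
  move: (u * n') k'^-1 ('C(n, k)%:R : R) (k`!%:R : R) => x y z w.
  lra.
have nm0 : 0 < n' ^+ m.+1 by rewrite exprn_gt0.
rewrite /rho mulrA ler_pdivlMr ?mulr_gt0//.
rewrite -(ler_pM2r n0).
have e : k`!%:R * (u * n' / k') * k' = k`!%:R * (u * n').
  by rewrite -mulrA divfK ?gt_eqF.
have := ler_wpM2r (ltW k0) h1; rewrite e.
rewrite [n' ^+ k]exprS.
by move: (k`!%:R : R) (n' ^+ m.+1) u n' k' => x y z v w; lra.
Qed.

(** Since [k! <= k^k <= n^(k/2)], the binomial is at least [n^(k/2) / 2]. The fifth power is enough
    to make [p] at most [n^(-3) / 2]. *)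
Lemma bin_ge_expr5 : n' ^+ 5 <= 'C(n, k)%:R.
Proof.
have n0 := n_gt0; have k0 : 0 < k' by rewrite ltr0n.
have n1 : 4 <= n'.
  by apply: le_trans (@a_exp_le_n 1 _) => //; rewrite expr1; have := a_ge; lra.
have h : n' ^+ k <= 2 * ('C(n, k)%:R * k' ^+ k).
  apply: le_trans exprn_le_2bin _; rewrite ler_wpM2l// ler_wpM2l ?ler0n//.
  by rewrite -natrX ler_nat -ffactnn ffact_le_expn.
have hk : (k' ^+ k) ^+ 2 <= n' ^+ k.
  rewrite exprAC lerXn2r ?nnegrE ?sqr_ge0 ?ler0n//.
  apply: le_trans (@a_exp_le_n 2 _) => //.
  by rewrite lerXn2r ?nnegrE ?(ltW a_gt0) ?ler0n ?k_le_a.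
rewrite -ler_sqr ?nnegrE ?exprn_ge0 ?ler0n//.
have h2 : (n' ^+ k) ^+ 2 <= (4 * 'C(n, k)%:R ^+ 2) * n' ^+ k.
  apply: le_trans (_ : (2 * ('C(n, k)%:R * k' ^+ k)) ^+ 2 <= _).
    have ck0 : 0 <= 'C(n, k)%:R * k' ^+ k by rewrite mulr_ge0 ?exprn_ge0 ?ler0n.
    by rewrite lerXn2r ?nnegrE ?exprn_ge0 ?ler0n// mulr_ge0.
  rewrite (_ : _ ^+ 2 = (4 * 'C(n, k)%:R ^+ 2) * (k' ^+ k) ^+ 2); last first.
    by move: (k' ^+ k) => x; ring.
  by rewrite ler_wpM2l// mulr_ge0 ?sqr_ge0.
have {h2} h2 : n' ^+ k <= 4 * 'C(n, k)%:R ^+ 2.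
  by move: h2; rewrite expr2 ler_pM2r ?exprn_gt0.
rewrite -(@ler_pM2l _ 4)//; apply: le_trans h2.
rewrite -exprM; apply: le_trans (_ : n' ^+ 11 <= _).
  by rewrite [leRHS]exprS ler_wpM2r ?exprn_ge0 ?ler0n.
apply: ler_weXn2l; first by lra.
by apply: leq_trans k_ge; rewrite (@leq_mul 11 1).
Qed.

Lemma p_bin_le : p * 'C(n, k)%:R <= n' ^+ 2 / 2.
Proof.
have n0 := n_gt0; have u0 := u_gt0.
apply: le_trans p_le _.
rewrite ler_pdivrMr ?mulr_gt0 ?ltr0n// mulrA divfK//.
rewrite expr2 -[leLHS]mulr1 ler_pM ?mulr_ge0 ?ler0n ?(ltW u0)//.
  rewrite ler_wpM2r ?ler0n//; apply: le_trans u_sqr_le_n.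
  rewrite expr2 ler_peMl ?(ltW u0)//.
  by apply: le_trans a_exp_le_u; apply: exprn_ege1; have := a_ge; lra.
by rewrite ler1n.
Qed.

Lemma p_small : p <= 1 / 2 /\ p ^+ 2 * 'C(n, k)%:R <= a^-1.
Proof.
have n0 := n_gt0; have a0 := a_gt0.
have an : a <= n' by have := @a_exp_le_n 1 isT; rewrite expr1.
have n1 : 1 <= n' by have := a_ge; lra.
have pn : p * n' ^+ 3 <= 1 / 2.
  have n20 : 0 < n' ^+ 2 by rewrite exprn_gt0.
  rewrite -(ler_pM2r n20); apply: le_trans (_ : p * 'C(n, k)%:R <= _).
    by rewrite -mulrA ler_wpM2l// -exprD bin_ge_expr5.
  by apply: le_trans p_bin_le _; lra.
split.
  apply: le_trans pn; rewrite ler_peMr// exprn_ege1//.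
rewrite expr2 -mulrA; apply: le_trans (ler_wpM2l p_ge0 p_bin_le) _.
rewrite -[leRHS]mul1r ler_pdivlMr//.
apply: le_trans (_ : p * (n' ^+ 2 / 2) * n' <= _).
  by rewrite ler_wpM2l// mulr_ge0// divr_ge0 ?sqr_ge0.
by move: pn; rewrite !exprS expr0 mulr1; move: n' => y; lra.
Qed.

Lemma inv_u_bounds : 0 <= inv_u R r m <= a^-1 /\ a * inv_u R r m <= a^-1.
Proof.
have a0 := a_gt0; have u0 := u_gt0.
have a1 : 1 <= a by have := a_ge; lra.
rewrite /inv_u exprVn invr_ge0 (ltW u0) /=; split.
  by rewrite lef_pV2 ?posrE//; apply: le_trans a_exp_le_u; rewrite ler_eXnr.
rewrite ler_pdivrMr// [leRHS]mulrC ler_pdivlMr//; apply: le_trans a_exp_le_u.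
by rewrite -expr2 a_exp_mono.
Qed.

Lemma taylor_excess_ge0 c d : 0 <= taylor_excess R m c d.
Proof.
apply: sumr_ge0 => i _; apply: sumr_ge0 => j _; rewrite subr_ge0.
by apply: tangent_le_exprn; rewrite ?divr_ge0 ?ler0n.
Qed.

(** The error [22 / a] is the sum of [2 / a] from the [p^2] term and [20 / a] from the two
    corrections of degree [k - 1], which total [20 a / u]. *)
Lemma pair_exponent_le c d (w := (1 - inv_u R r m)^-1) : balanced c ->
  p * w ^+ 2 *
  (inv_u R r m ^+ 2 * 'C(n, k)%:R
   - inv_u R r m * (\sum_i 'C(class_size c i, k)%:R)
   - inv_u R r m * (\sum_i 'C(class_size d i, k)%:R)
   + \sum_i \sum_j 'C(cell_size c d i j, k)%:R) + 2 * p ^+ 2 * 'C(n, k)%:R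
  <= rho * taylor_excess R m c d + 22 * a^-1.
Proof.
move=> cB.
have r0 : 0 < r' by have := natr_r_ge; lra.
have n0 := n_gt0; have k0 : 0 < k' by rewrite ltr0n.
have a0 := a_gt0; have u0 := u_gt0.
have [/andP[b0 ba] ab] := inv_u_bounds.
have [_ p2] := p_small.
have ai : a^-1 <= 1 / 2 by rewrite div1r lef_pV2 ?posrE//; have := a_ge; lra.
have := pair_excess_le R m r2 c d; set X := (_ + \sum_i _) => hX.
set T := taylor_excess R m c d in hX *.
have T0 : 0 <= T := taylor_excess_ge0 c d.
set b := inv_u R r m in b0 ba ab hX w *.
have b2 : b <= 1 / 2 := le_trans ba ai.
clear ba.
have w2 : w ^+ 2 <= 4.
  have w0 : 0 < 1 - b by lra.
  rewrite (_ : 4 = 2 ^+ 2); last by ring.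
  rewrite lerXn2r ?nnegrE ?invr_ge0 ?(ltW w0)//.
  rewrite -[leRHS]invrK lef_pV2 ?posrE ?invr_gt0//; lra.
have hs : \sum_i (class_size c i)%:R ^+ m.+1 <= 4 * r' * b * n' ^+ m.+1.
  apply: le_trans (_ : \sum_(i < r) max_size ^+ m.+1 <= _).
    apply: ler_sum => i _; rewrite lerXn2r ?nnegrE ?ler0n ?max_size_ge0//.
    exact: balanced_le.
  rewrite sumr_const card_ord -[leLHS]mulr_natl.
  apply: le_trans (ler_wpM2l (ltW r0) (max_size_exp (leqnSn m.+1))) _.
  rewrite expr_div_n /b /inv_u exprVn.
  by move: (n' ^+ m.+1) (u^-1) r' => x y z; rewrite le_eqVlt; apply/orP; left;
    apply/eqP; ring.
pose Y := T + 5 * b ^+ 2 * r' * k' ^+ 2 * n' ^+ m.+1.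
have Y0 : 0 <= Y.
  by rewrite addr_ge0// mulr_ge0 ?exprn_ge0 ?ler0n// mulr_ge0 ?sqr_ge0// mulr_ge0
    ?ler0n// mulr_ge0 ?sqr_ge0.
have {}hX : X * k`!%:R <= Y.
  apply: le_trans hX _; rewrite /Y.
  have bk : 0 <= b * k' ^+ 2 by rewrite mulr_ge0 ?sqr_ge0.
  have := ler_wpM2l bk hs.
  move: (\sum_i _) (n' ^+ m.+1) (k' ^+ 2) => x y z; rewrite expr2; lra.
have hpX : p * w ^+ 2 * X <= rho * Y.
  have f0 : 0 < k`!%:R :> R by rewrite ltr0n fact_gt0.
  rewrite -(ler_pM2r f0) -[leLHS]mulrA.
  apply: le_trans (ler_wpM2l _ hX) _; first by rewrite mulr_ge0 ?sqr_ge0.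
  apply: le_trans (_ : 4 * p * Y <= _).
    by rewrite ler_wpM2r// [leLHS]mulrC ler_wpM2r.
  by rewrite [leRHS]mulrAC ler_wpM2r// [leRHS]mulrC four_p_le.
have hr : rho * (5 * b ^+ 2 * r' * k' ^+ 2 * n' ^+ m.+1) = 20 * (a * b).
  rewrite /rho /b /inv_u exprVn.
  have nm : n' ^+ m.+1 != 0 by rewrite gt_eqF// exprn_gt0.
  move: nm (lt0r_neq0 u0) (lt0r_neq0 k0).
  move: (n' ^+ m.+1) u k' r' => x y z v x0 y0 z0.
  by field; rewrite x0 y0 z0.
apply: le_trans (lerD hpX (_ : _ <= 2 * a^-1)) _.
  by rewrite -mulrA ler_wpM2l.
rewrite /Y mulrDr hr; move: (rho * T) ab; move: a^-1 (a * b) => x y z; lra.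
Qed.

Lemma Hnkp_prob_colorable_ge_inv :
  1 - 100 * a^-1 <= Hnkp_prob k p (@colorable 'I_n r).
Proof.
have r0 : 0 < r' by have := natr_r_ge; lra.
have a0 := a_gt0; have [p2 _] := p_small.
have [/andP[b0 ba] _] := inv_u_bounds.
have ai : a^-1 <= 1 / 200.
  by rewrite -[leLHS]div1r ler_pdivrMr//; have := a_ge; move: a => y; lra.
have ai0 : 0 < a^-1 by rewrite invr_gt0.
have b1 : inv_u R r m <= 1 / 200 := le_trans ba ai.
have hB := card_balanced_ge.
have hS := sum_expR_excess; have hE := pair_exponent_le.
move: ba ai ai0 hB hS hE; move: a^-1 => x ba ai ai0 hB hS hE.
pose w := (1 - inv_u R r m)^-1.
have w0 : 0 < 1 - inv_u R r m by lra.
have w12 : 1 <= w <= 2.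
  rewrite /w invf_ge1// lerBlDr lerDl b0 /= -[leRHS]invrK lef_pV2 ?posrE
    ?invr_gt0//.
  by lra.
have [w1 w2] := andP w12.
pose h c (e : {set 'I_n}) : R := w * (~~ monochromatic c e)%:R.
pose B := [set c : {ffun 'I_n -> 'I_r} | balanced c].
have p01 : 0 <= p <= 1 by rewrite p_ge0 /=; lra.
have p012 : 0 <= p <= 1 / 2 by rewrite p_ge0.
have hz c : \prod_(e : {set 'I_n} | #|e| == k) (1 - p + p * h c e) != 0.
  rewrite gt_eqF// prodr_gt0// => e _; rewrite ltr_wpDr//; last by lra.
  by rewrite !mulr_ge0 ?ler0n//; lra.
have hmono c e : monochromatic c e -> h c e = 0 by rewrite /h => ->; rewrite mulr0.
rewrite -/B in hB.
have rn0 : 0 < r' ^+ n by rewrite exprn_gt0.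
have B0 : 0 < #|B|%:R :> R.
  by apply: lt_le_trans hB; rewrite mulr_gt0//; lra.
have B0' : (0 < #|B|)%N by rewrite -(ltr_nat R).
apply: le_trans (Hnkp_prob_colorable_ge p01 B0' hmono hz).
set Q := _ * \sum_(c in B) _.
suff : Q <= 1 + 100 * x by lra.
have inner c : c \in B -> \sum_(d in B)
      \prod_(e : {set 'I_n} | #|e| == k)
        ((1 - p + p * (h c e * h d e)) /
         ((1 - p + p * h c e) * (1 - p + p * h d e))) <=
      expR (22 * x) * (r' ^+ n * (expR (32 * x) + x)).
  rewrite inE => cB.
  apply: le_trans (ler_wpM2l (expR_ge0 _) (hS c cB)).
  (* The inner sum is enlarged from balanced [d] to all [d], the range of the exponential moment. *)
  rewrite mulr_sumr [leLHS]big_mkcond; apply: ler_sum => d _.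
  case: ifP => _; last by rewrite mulr_ge0 ?expR_ge0.
  rewrite -expRD [22 * x + _]addrC.
  have h0 c' e : 0 <= 1 - p + p * h c' e.
    by rewrite addr_ge0 ?mulr_ge0 ?ler0n//; lra.
  have hh0 e : 0 <= 1 - p + p * (h c e * h d e).
    by rewrite addr_ge0 ?mulr_ge0 ?ler0n//; lra.
  apply: le_trans (_ : \prod_(e : {set 'I_n} | #|e| == k) expR
     (p * ((w - 1) ^+ 2 -
        ((monochromatic c e)%:R + (monochromatic d e)%:R) * (w * (w - 1)) +
        (monochromatic c e && monochromatic d e)%:R * w ^+ 2) + 2 * p ^+ 2) <= _).
    apply: ler_prod => e _; rewrite divr_ge0 ?hh0 ?mulr_ge0//=.
    exact: (@edge_ratio_le R p w (monochromatic c e) (monochromatic d e) p012 w12).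
  rewrite -expR_sum ler_expR edge_exponent_sum ?gt_eqF//.
  exact: hE.
have hQ : Q <= expR (22 * x) * (expR (32 * x) + x) * (r' ^+ n / #|B|%:R).
  rewrite /Q; apply: le_trans (ler_wpM2l _ (ler_sum _ inner)) _.
    by rewrite invr_ge0 exprn_ge0 ?ltW.
  rewrite sumr_const -[X in _ * X <= _]mulr_natl.
  move: (r' ^+ n) (expR (32 * x)) (expR (22 * x)) => y1 y2 y3.
  move: (lt0r_neq0 B0); move: (#|B|%:R : R) => v v0.
  by rewrite le_eqVlt; apply/orP; left; apply/eqP; field.
have hrB : r' ^+ n / #|B|%:R <= 1 + 2 * x.
  rewrite ler_pdivrMr//.
  have t0 : 0 <= 1 + 2 * x by lra.
  apply: le_trans (ler_wpM2l t0 hB); rewrite mulrA.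
  by rewrite ler_peMl ?(ltW rn0)//; nra.
have x1 : expR (22 * x) <= 1 + 27 * x.
  by apply: le_trans (@expR_le_quadratic R _ _) _; [lra|nra].
have x2 : expR (32 * x) <= 1 + 43 * x.
  by apply: le_trans (@expR_le_quadratic R _ _) _; [lra|nra].
apply: le_trans hQ _.
(* The factors come from the error in the exponent, the moment of the excess, and the share of
   balanced colorings. As [x <= 1 / 200], their linear terms [73 x] leave room for the higher
   ones. *)
apply: le_trans (_ : (1 + 27 * x) * (1 + 44 * x) * (1 + 2 * x) <= _).
  rewrite ler_pM ?mulr_ge0 ?addr_ge0 ?expR_ge0 ?divr_ge0 ?(ltW rn0) ?(ltW B0)
    ?(ltW ai0)//.
  by rewrite ler_pM ?addr_ge0 ?expR_ge0 ?(ltW ai0)//; lra.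
have e1 : x * x <= x * (1 / 200) by rewrite ler_wpM2l ?(ltW ai0).
have e2 : x * (x * x) <= x * (x * (1 / 200)) by rewrite ler_wpM2l ?(ltW ai0).
by move: e1 e2 ai; lra.
Qed.

End CoreEstimate.

(** * From the logarithmic hypotheses to the inequalities used for fixed [n] *)

(** With [q = k / 32] rounded down, [k <= 32 (q + 1) <= 2^(5 + q)], so [k^16] costs about [k / 2]
    factors of [r]. *)
Lemma exp16_le (k r : nat) : (128 * 128 <= k)%N -> (2 <= r)%N ->
  ((k * r) ^ 16 <= r ^ (k - 1))%N.
Proof.
move=> kK r2.
have r0 : (0 < r)%N := ltnW r2.
pose q := (k %/ 32)%N.
have kq : (k <= 2 ^ (5 + q))%N.
  rewrite expnD; apply: leq_trans (_ : 32 * q.+1 <= _)%N.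
    by rewrite mulnC ltnW// ltn_ceil.
  by rewrite leq_mul2l ltn_expl.
have q16 : (16 * (5 + q) + 16 <= k - 1)%N.
  have : (q * 32 <= k)%N := leq_trunc_div k 32.
  have : (256 <= k)%N by apply: leq_trans kK.
  by move=> *; lia.
apply: leq_trans (_ : 2 ^ (16 * (5 + q)) * r ^ 16 <= _)%N.
  by rewrite expnMn leq_mul// mulnC expnM leq_exp2r.
apply: leq_trans (_ : r ^ (16 * (5 + q)) * r ^ 16 <= _)%N.
  by rewrite leq_mul// leq_exp2r// addn_gt0.
by rewrite -expnD leq_exp2l.
Qed.

(** This covers small [k] too: if the floor is zero, so is its inverse. *)
Lemma varphi_ge0 (R : realType) (k : nat) : 0 <= varphi R k.
Proof. by rewrite mulr_ge0 ?invr_ge0 ?ler0z ?floor_ge0 ?sqrtr_ge0. Qed.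

Section NumericHypotheses.
Variables (R : realType) (k r n : nat).
Hypotheses (k_gt0 : (0 < k)%N) (r_gt1 : (2 <= r)%N).

Lemma expn_sqr_le (delta : R) : 0 < delta -> (0 < n)%N ->
  (k - 1)%:R * ln (r%:R : R) < (1 - delta) / 2 * ln (n%:R : R) ->
  ((r ^ (k - 1)) ^ 2 <= n)%N.
Proof.
move=> d0 n0 h.
have rp : (0 < r)%N := ltnW r_gt1.
have r0 : 0 < r%:R :> R by rewrite ltr0n.
have ln0 : 0 <= ln (n%:R : R) by rewrite ln_ge0// ler1n.
rewrite -(ler_nat R) natrX natrX -ler_ln ?posrE ?exprn_gt0 ?ltr0n//.
rewrite -exprM lnXn// -[leLHS]mulr_natl natrM.
have : 0 <= delta * ln (n%:R : R) by rewrite mulr_ge0 ?(ltW d0).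
move: h; move: (ln (r%:R : R)) (ln (n%:R : R)) ((k - 1)%:R : R) => x y z.
lra.
Qed.

Lemma edge_density_le (p : R) : (k <= n)%N ->
  p <= 1 / 2 * (r%:R ^+ (k - 1) / k%:R `^ (1 + varphi R k)) * (n%:R / 'C(n,
    k)%:R) ->
  p * 'C(n, k)%:R <= r%:R ^+ (k - 1) * n%:R / (2 * k%:R).
Proof.
move=> kn hp.
have C0 : 0 < 'C(n, k)%:R :> R by rewrite ltr0n bin_gt0.
have k1 : 1 <= k%:R :> R by rewrite ler1n.
have k0 : 0 < k%:R :> R by rewrite ltr0n.
apply: le_trans (ler_wpM2r (ltW C0) hp) _.
rewrite -[leLHS]mulrA divfK ?gt_eqF//.
have hk : (k%:R `^ (1 + varphi R k))^-1 <= k%:R^-1.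
  rewrite lef_pV2 ?posrE ?powR_gt0// -{1}[k%:R](powRr1 (ltW k0)).
  by rewrite ler_powR// lerDl varphi_ge0.
have x0 : 0 <= r%:R ^+ (k - 1) * n%:R :> R by rewrite mulr_ge0 ?exprn_ge0 ?ler0n.
have := ler_wpM2l x0 hk; rewrite [(2 * _)^-1]invfM.
move: (r%:R ^+ (k - 1)) (n%:R : R) (_ `^ _)^-1 (k%:R^-1) => x y z w.
lra.
Qed.

(** This forces [k r] to infinity with [n], which makes the error [100 / (k r)] vanish. *)
Lemma ln_le_expn_self :
  6 * ln (n%:R : R) <= r%:R ^+ (k - 1) * k%:R `^ (- varphi R k) ->
  6 * ln (n%:R : R) <= ((k * r) ^ (k * r))%:R.
Proof.
move=> /le_trans; apply.
have r0 : (0 < r)%N := ltnW r_gt1.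
apply: le_trans (_ : r%:R ^+ (k - 1) <= _).
  rewrite ler_piMr ?exprn_ge0 ?ler0n// -[leRHS](powRr0 k%:R).
  by rewrite ler_powR ?ler1n// oppr_le0 varphi_ge0.
rewrite -natrX ler_nat; apply: leq_trans (_ : (k * r) ^ (k - 1) <= _)%N.
  by rewrite expnMn leq_pmull// expn_gt0 k_gt0.
rewrite leq_pexp2l ?muln_gt0 ?k_gt0 ?r0//.
by apply: leq_trans (leq_subr _ _) _; rewrite leq_pmulr.
Qed.

End NumericHypotheses.

(** * Passage to the limit *)

Local Open Scope classical_set_scope.

Theorem theorem3 (R : realType) (delta : R) (hdelta : 0 < delta < 1) :
  exists k0 : nat,
  forall (k r : nat -> nat),
    (\forall n \near \oo, (2 <= k n < n)%N) ->
    (\forall n \near \oo, (2 <= r n)%N) ->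
    (\forall n \near \oo, (k0 <= k n)%N) ->
    (\forall n \near \oo,
       (k n - 1)%:R * ln ((r n)%:R : R) < (1 - delta) / 2 * ln (n%:R : R)) ->
    (\forall n \near \oo,
       6 * ln (n%:R : R)
         <= (r n)%:R ^+ (k n - 1) * (k n)%:R `^ (- varphi R (k n))) ->
  forall p : nat -> R,
    (\forall n \near \oo, 0 <= p n <= 1) ->
    (\forall n \near \oo,
       p n <= 1 / 2 * ((r n)%:R ^+ (k n - 1) / (k n)%:R `^ (1 + varphi R (k n)))
                * (n%:R / 'C(n, k n)%:R)) ->
  (fun n : nat => Hnkp_prob (k n) (p n) (@colorable 'I_n (r n))) @ \oo --> (1 : R).
Proof.
case/andP: hdelta => d0 _.
exists (128 * 128)%N => k r kn r2 kK hln hlow p p01 hp.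
apply/cvgrPdist_le => e e0.
pose M := Num.bound (100 / e).
have M0 : 100 / e < M%:R by apply: archi_boundP; rewrite divr_ge0// ltW.
(* If [k r <= M], then [6 ln n <= (k r)^(k r) <= M^M], which fails once [n >= exp c]. *)
pose c : R := (M ^ M)%:R.
near=> n.
have /andP[k2 kn'] : (2 <= k n < n)%N by near: n.
have r2' : (2 <= r n)%N by near: n.
have kK' : (128 * 128 <= k n)%N by near: n.
have hln' : (k n - 1)%:R * ln ((r n)%:R : R) < (1 - delta) / 2 * ln (n%:R : R).
  by near: n.
have hlow' : 6 * ln (n%:R : R)
    <= (r n)%:R ^+ (k n - 1) * (k n)%:R `^ (- varphi R (k n)) by near: n.
have hp' : p n <= 1 / 2 * ((r n)%:R ^+ (k n - 1) / (k n)%:R `^ (1 + varphi R (k n)))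
                * (n%:R / 'C(n, k n)%:R) by near: n.
have p01' : 0 <= p n <= 1 by near: n.
have nbig : (Num.bound (expR c) <= n)%N by near: n; exact: nbhs_infty_ge.
have n0 : (0 < n)%N := leq_ltn_trans (leq0n _) kn'.
have k0 : (0 < k n)%N := ltnW k2.
have kr0 : (0 < k n * r n)%N by rewrite muln_gt0 k0 ltnW.
have c_lt : c < 6 * ln (n%:R : R).
  have cn : c <= ln (n%:R : R).
    rewrite -(expRK c) ler_ln ?posrE ?expR_gt0 ?ltr0n//.
    by apply: le_trans (ltW (archi_boundP (expR_ge0 c))) _; rewrite ler_nat.
  have : 0 < c by rewrite ltr0n expn_gt0; case: (M) => //.
  lra.
have krM : (M < k n * r n)%N.
  rewrite ltnNge; apply/negP => krM.
  have := ln_le_expn_self k0 r2' hlow'; apply/negP; rewrite -ltNge.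
  apply: le_lt_trans c_lt; rewrite /c ler_nat.
  apply: leq_trans (leq_pexp2l kr0 krM) _.
  by rewrite leq_exp2r// (leq_trans kr0 krM).
have [p0 p1] := andP p01'.
have bound : 1 - 100 / ((k n)%:R * (r n)%:R) <=
    Hnkp_prob (k n) (p n) (@colorable 'I_n (r n)).
  have h1 := exp16_le kK' r2'.
  have h2 := expn_sqr_le r2' d0 n0 hln'.
  have h3 := edge_density_le k0 (ltnW kn') hp'.
  move: h1 h2 h3 k2 kK'; case: (k n) => [|[|m]]//; rewrite subn1 => h1 h2 h3 _ kK'.
  exact: Hnkp_prob_colorable_ge_inv.
have le1 := Hnkp_prob_le1 (k n) p01' (@colorable 'I_n (r n)).
rewrite ger0_norm ?subr_ge0// lerBlDr -lerBlDl; apply: le_trans bound.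
rewrite lerD2l lerN2 -natrM ler_pdivrMr ?ltr0n// mulrC -ler_pdivrMr//.
by apply: le_trans (ltW M0) _; rewrite ler_nat ltnW.
Unshelve. all: by end_near.
Qed.
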